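(* Let $K$ be a field, $c\ge1$ an integer and $\mathcal{P}=K[X_{c\times\mathbb{N}}]$. There is a finite algorithm which, given as input an integer $s\ge1$ and a finite subset $B$ of a finitely generated free $\operatorname{Inc}$-module $\mathcal{F}=\bigoplus_{i=1}^r\mathcal{F}^{\operatorname{Inc},d_i}$ over $\mathcal{P}$ (with integers $d_i\ge0$), outputs an exact sequence of finitely generated $\operatorname{Inc}$-modules over $\mathcal{P}$ $$\mathcal{F}_s\to\mathcal{F}_{s-1}\to\cdots\to\mathcal{F}_1\to\mathcal{M}\to0$$ with $\operatorname{Inc}$-equivariant differentials, where $\mathcal{M}=\langle B\rangle_{\mathcal{F}}$ is the $\operatorname{Inc}$-submodule of $\mathcal{F}$ generated by $B$ and the $\mathcal{F}_i$ are free $\operatorname{Inc}$-modules.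
   Context: $\mathbb{N}=\{1,2,\dots\}$. $\operatorname{Inc}$ is the monoid (under composition) of strictly increasing maps $\mathbb{N}\to\mathbb{N}$. $\mathcal{P}=K[X_{c\times\mathbb{N}}]=K[x_{i,j}\mid 1\le i\le c,\ j\in\mathbb{N}]$, with $\operatorname{Inc}$ acting by $K$-algebra homomorphisms via $\tau\cdot x_{i,j}=x_{i,\tau(j)}$. An $\operatorname{Inc}$-module over $\mathcal{P}$ is a $\mathcal{P}$-module $\mathcal{M}$ with an action of the monoid $\operatorname{Inc}$ satisfying $\tau\cdot(q_1+q_2)=\tau\cdot q_1+\tau\cdot q_2$ and $\tau\cdot(aq)=(\tau\cdot a)(\tau\cdot q)$. Morphisms are the $\operatorname{Inc}$-equivariant $\mathcal{P}$-module homomorphisms. The $\operatorname{Inc}$-submodule generated by a subset is the smallest $\operatorname{Inc}$-stable $\mathcal{P}$-submodule containing it; an $\operatorname{Inc}$-module is finitely generated if it is generated in this sense by a finite subset. For $d\ge0$ let $\operatorname{Hom}_{\mathrm{OI}}(d,\mathbb{N})$ be the set of strictly increasing maps $\{1,\dots,d\}\to\mathbb{N}$. Let $\mathcal{F}^{\operatorname{Inc},d}=\bigoplus_{\pi\in\operatorname{Hom}_{\mathrm{OI}}(d,\mathbb{N})}\mathcal{P}\,\epsilon_\pi$ with action induced by $\tau\cdot(a\epsilon_\pi)=(\tau\cdot a)\epsilon_{\tau\circ\pi}$; as an $\operatorname{Inc}$-module it is generated by $\epsilon_{\widetilde{\mathrm{id}_d}}$, where $\widetilde{\mathrm{id}_d}(j)=j$.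 A free $\operatorname{Inc}$-module is one isomorphic to a direct sum of modules $\mathcal{F}^{\operatorname{Inc},d_\lambda}$. Conventions on computation: the field operations and equality tests in $K$ count as elementary steps; elements of free modules are given explicitly as finite linear combinations of basis elements with polynomial coefficients; morphisms out of free $\operatorname{Inc}$-modules are given by the images of the generators $\epsilon_{\widetilde{\mathrm{id}_{d_i}},i}$. A finite algorithm is one that terminates after finitely many steps on every input. *)

(* Defs.v *)
From HB Require Import structures.
From mathcomp Require Import all_boot all_order all_algebra.
From mathcomp Require Import finmap.
From mathcomp.multinomials Require Import monalg.

Set Implicit Arguments.
Unset Strict Implicit.
Unset Printing Implicit Defensive.

Import GRing.Theory.
Local Open Scope ring_scope.

(* The positive integers are represented by nat through j |-> j - 1: columns,
   and the sets {1,...,d}, are numbered from 0. *)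

Record Inc := MkInc {
  Inc_fun :> nat -> nat;
  Inc_mono : {homo Inc_fun : i j / (i < j)%N}
}.

Definition Inc_id : Inc := @MkInc id (fun _ _ h => h).

Fact Inc_comp_mono (s t : Inc) : {homo s \o t : i j / (i < j)%N}.
Proof. by move=> i j ij; do 2!apply: Inc_mono. Qed.

Definition Inc_comp (s t : Inc) : Inc := MkInc (Inc_comp_mono s t).

(* Hom_OI(d, N) *)
Definition OI (d : nat) :=
  {f : {ffun 'I_d -> nat} | [forall i : 'I_d, forall j : 'I_d, (i < j)%N ==> (f i < f j)%N]}.
HB.instance Definition _ d := Choice.on (OI d).

Lemma OI_mono d (f : OI d) (i j : 'I_d) : (i < j)%N -> (val f i < val f j)%N.
Proof. by case: f => f /= /forallP/(_ i)/forallP/(_ j)/implyP. Qed.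

Fact OI_id_subproof d :
  [forall i : 'I_d, forall j : 'I_d, (i < j)%N ==>
     ([ffun k : 'I_d => (k : nat)] i < [ffun k : 'I_d => (k : nat)] j)%N].
Proof. by apply/forallP=> i; apply/forallP=> j; rewrite !ffunE implybb. Qed.

Definition OI_id d : OI d := exist _ [ffun k : 'I_d => (k : nat)] (OI_id_subproof d).

Fact OI_act_subproof (t : Inc) d (f : OI d) :
  [forall i : 'I_d, forall j : 'I_d, (i < j)%N ==>
     ([ffun k => t (val f k)] i < [ffun k => t (val f k)] j)%N].
Proof.
apply/forallP=> i; apply/forallP=> j; apply/implyP=> ij.
by rewrite !ffunE; apply/Inc_mono/OI_mono.
Qed.

Definition OI_act (t : Inc) d (f : OI d) : OI d :=
  exist _ [ffun k => t (val f k)] (OI_act_subproof t f).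

Section IncModules.
Context (K : fieldType) (c : nat).

Definition var : choiceType := ('I_c * nat)%type.

(* P = K[X_{c x N}] *)
Definition pol : comNzRingType := {malg K[{cmonom var}]}.

Definition pX (v : var) : pol := << (ucm v : {cmonom var}) >>.
Definition pC : K -> pol := @malgC {cmonom var} K.
HB.instance Definition _ := GRing.RMorphism.copy pC
  (@malgC {cmonom var} K).

Definition mon_act (t : Inc) (m : {cmonom var}) : pol :=
  \prod_(v <- finsupp m) pX (v.1, t v.2) ^+ m v.

Lemma mon_actEw t (m : {cmonom var}) (D : {fset var}) : (finsupp m `<=` D)%fset ->
  mon_act t m = \prod_(v <- D) pX (v.1, t v.2) ^+ m v.
Proof.
move=> le; rewrite /mon_act; apply: (big_fset_incl _ le) => v _ vm.
by rewrite (fsfun_dflt vm) expr0.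
Qed.

Fact mon_act_mmorphism t : mmorphism (mon_act t).
Proof.
split=> [m1 m2|]; last by rewrite /mon_act mdom1 big_seq_fset0.
rewrite (@mon_actEw t m1 (finsupp m1 `|` finsupp m2)%fset) ?fsubsetUl //.
rewrite (@mon_actEw t m2 (finsupp m1 `|` finsupp m2)%fset) ?fsubsetUr //.
rewrite -big_split /= /mon_act mdomD; apply: eq_bigr => v _.
by rewrite cmM exprD.
Qed.

HB.instance Definition _ t :=
  isMultiplicative.Build {cmonom var} pol (mon_act t)
    (mon_act_mmorphism t).

(* the K-algebra endomorphism x_{i,j} |-> x_{i,t(j)} *)
Definition pol_act (t : Inc) : pol -> pol := mmap pC (mon_act t).

HB.instance Definition _ t :=
  GRing.RMorphism.copy (pol_act t) (mmap pC (mon_act t)).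

Lemma pol_actX t v : pol_act t (pX v) = pX (v.1, t v.2).
Proof.
rewrite /pol_act /pX mmapU /= rmorph1 mul1r /mon_act mdomU big_seq_fset1.
by rewrite cmUU expr1.
Qed.

Lemma pol_actC t a : pol_act t (pC a) = pC a.
Proof. by rewrite /pol_act mmapC. Qed.

Lemma polMU (a b : K) (m1 m2 : {cmonom var}) :
  << a *g m1 >> * << b *g m2 >> = << a * b *g mmul m1 m2 >> :> pol.
Proof. by rewrite [LHS]malgM_def fgmulUU. Qed.

Lemma pol1E : << mone >> = 1 :> pol.
Proof. exact: mpolyC1E. Qed.

Lemma mon_act_id (m : {cmonom var}) : mon_act Inc_id m = << m >>.
Proof.
have cm_exp v n : pX v ^+ n = << iter n (mmul (ucm v)) mone >>.
  elim: n => [|n IHn]; first by rewrite expr0 -pol1E.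
  rewrite exprS IHn /= /pX polMU mulr1; reflexivity.
have cm_prod (r : seq var) (e : var -> nat) : \prod_(v <- r) pX v ^+ e v =
    << \big[mmul/mone]_(v <- r) iter (e v) (mmul (ucm v)) mone >>.
  elim: r => [|v r IHr]; first by rewrite !big_nil -pol1E.
  rewrite !big_cons IHr cm_exp polMU mulr1; reflexivity.
have -> : mon_act Inc_id m = \prod_(v <- finsupp m) pX v ^+ (m v).
  by rewrite /mon_act; apply: eq_bigr => -[i k] _.
rewrite (cm_prod (finsupp m) (fun v => m v)).
have -> // : \big[mmul/mone]_(v <- finsupp m) iter (m v) (mmul (ucm v)) mone = m.
apply/eqP/cmP => i.
have cm_big (r : seq var) (F : var -> {cmonom var}) :
    (\big[mmul/mone]_(v <- r) F v) i = (\sum_(v <- r) F v i)%N.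
  by elim: r => [|v r IHr]; rewrite ?big_nil ?cm1 // !big_cons cmM IHr.
rewrite cm_big.
have it v n : iter n (mmul (ucm v)) mone i = (n * (v == i))%N.
  by elim: n => [|n IHn]; rewrite /= ?cm1 // cmM cmU IHn mulSn.
under eq_bigr do rewrite it.
have [im|im] := boolP (i \in finsupp m).
  rewrite (big_fsetD1 i) //= eqxx muln1 big1_fset ?addn0 // => v.
  by rewrite in_fsetD1 => /andP[/negPf->]; rewrite muln0.
rewrite (fsfun_dflt im) big1_fset // => v vm _.
by case: eqP vm im => [->->//|]; rewrite muln0.
Qed.

Lemma pol_act_id p : pol_act Inc_id p = p.
Proof.
rewrite [RHS]monalgE /pol_act mmapE; apply: eq_bigr => m _.
by rewrite mon_act_id /pC polMU mulr1 mul1m.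
Qed.

Lemma mon_act_comp s t m : pol_act s (mon_act t m) = mon_act (Inc_comp s t) m.
Proof.
rewrite /mon_act rmorph_prod; apply: eq_bigr => v _.
by rewrite rmorphXn /= pol_actX.
Qed.

Lemma pol_act_comp s t p : pol_act (Inc_comp s t) p = pol_act s (pol_act t p).
Proof.
have -> : pol_act t p = \sum_(m <- msupp p) pC p@_m * mon_act t m by [].
rewrite rmorph_sum /=; apply: eq_bigr => m _.
by rewrite rmorphM /= pol_actC mon_act_comp.
Qed.

Record incModule := IncModule {
  inc_car :> lmodType pol;
  inc_act : Inc -> inc_car -> inc_car;
  inc_act1 : forall q, inc_act Inc_id q = q;
  inc_actM : forall s t q, inc_act (Inc_comp s t) q = inc_act s (inc_act t q);
  inc_actD : forall t q1 q2, inc_act t (q1 + q2) = inc_act t q1 + inc_act t q2;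
  inc_actZ : forall t (a : pol) q, inc_act t (a *: q) = pol_act t a *: inc_act t q
}.

Record incHom (M N : incModule) := IncHom {
  inc_hom :> {linear M -> N};
  inc_homE : forall t q, inc_hom (inc_act t q) = inc_act t (inc_hom q)
}.

Definition incSubmodule (M : incModule) (S : M -> Prop) : Prop :=
  [/\ S 0, (forall x y, S x -> S y -> S (x + y)),
      (forall (a : pol) x, S x -> S (a *: x))
    & (forall t x, S x -> S (inc_act t x))].

(* the smallest Inc-submodule containing X *)
Definition incSpan (M : incModule) (X : M -> Prop) (x : M) : Prop :=
  forall S : M -> Prop, incSubmodule S -> (forall y, X y -> S y) -> S x.

Definition exact_at (L M N : incModule) (f : incHom L M) (g : incHom M N) : Prop :=
  forall x : M, g x = 0 <-> exists y : L, f y = x.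

Section FreeIncModule.
Context (L : choiceType) (d : L -> nat).

Definition fbasis : choiceType := {l : L & OI (d l)}.

Definition fbasis_act (t : Inc) (b : fbasis) : fbasis :=
  Tagged (fun l => OI (d l)) (OI_act t (tagged b)).

Definition free_car : lmodType pol := {malg pol[fbasis]}.

Definition free_act (t : Inc) (q : free_car) : free_car :=
  \sum_(b <- msupp q) << pol_act t q@_b *g fbasis_act t b >>.

Lemma free_actEw t (q : free_car) (D : {fset fbasis}) : (msupp q `<=` D)%fset ->
  free_act t q = \sum_(b <- D) << pol_act t q@_b *g fbasis_act t b >>.
Proof.
move=> le; rewrite /free_act; apply: (big_fset_incl _ le) => b _ bq.
by rewrite (mcoeff_outdom bq) rmorph0 monalgU0.
Qed.

Lemma free_actU t (a : pol) b :
  free_act t << a *g b >> = << pol_act t a *g fbasis_act t b >>.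
Proof. by rewrite (free_actEw _ msuppU_le) big_seq_fset1 mcoeffUU. Qed.

Lemma free_actD t (q1 q2 : free_car) :
  free_act t (q1 + q2) = free_act t q1 + free_act t q2.
Proof.
rewrite (free_actEw _ (msuppD_le q1 q2)).
rewrite (free_actEw t (fsubsetUl (msupp q1) (msupp q2))).
rewrite (free_actEw t (fsubsetUr (msupp q1) (msupp q2))) -big_split /=.
by apply: eq_bigr => b _; rewrite mcoeffD rmorphD monalgUD.
Qed.

Lemma free_actZ t (a : pol) (q : free_car) :
  free_act t (a *: q) = pol_act t a *: free_act t q.
Proof.
rewrite (free_actEw _ (msuppZ_le a q)) /free_act scaler_sumr.
apply: eq_bigr => b _; rewrite mcoeffZ rmorphM; apply/malgP => b'.
by rewrite mcoeffZ !mcoeffU mulrnAr.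
Qed.

Lemma fbasis_act1 b : fbasis_act Inc_id b = b.
Proof.
case: b => l f; rewrite /fbasis_act /=; congr existT.
by apply/val_inj/ffunP => i; rewrite /= ffunE.
Qed.

Lemma fbasis_actM s t b :
  fbasis_act (Inc_comp s t) b = fbasis_act s (fbasis_act t b).
Proof.
case: b => l f; rewrite /fbasis_act /=; congr existT.
by apply/val_inj/ffunP => i; rewrite /= !ffunE.
Qed.

Lemma free_act1 (q : free_car) : free_act Inc_id q = q.
Proof.
rewrite [RHS]monalgE /free_act; apply: eq_bigr => b _.
by rewrite pol_act_id fbasis_act1.
Qed.

Lemma free_actM s t (q : free_car) :
  free_act (Inc_comp s t) q = free_act s (free_act t q).
Proof.
have free_act0 r : free_act r 0 = 0.
  by rewrite /free_act msupp0 big_seq_fset0.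
rewrite [free_act t q]/free_act.
rewrite (big_morph (free_act s) (free_actD s) (free_act0 s)).
by apply: eq_bigr => b _; rewrite free_actU pol_act_comp fbasis_actM.
Qed.

(* the direct sum over l of the modules F^{Inc, d l}: the P-module on the
   disjoint union of the sets Hom_OI(d l, N) *)
Definition freeInc : incModule :=
  IncModule free_act1 free_actM free_actD free_actZ.

(* the generator eps_{id_(d l), l} *)
Definition fgen (l : L) : freeInc :=
  << 1 *g (Tagged (fun l => OI (d l)) (OI_id (d l)) : fbasis) >>.

End FreeIncModule.

(* F^{Inc, ds_0} (+) ... (+) F^{Inc, ds_(r-1)}, where r = size ds *)
Definition fdeg (ds : seq nat) (i : 'I_(size ds)) : nat := nth 0%N ds i.
Definition freeSeq (ds : seq nat) : incModule := freeInc (@fdeg ds).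
Definition fseq_gen (ds : seq nat) (i : 'I_(size ds)) : freeSeq ds :=
  fgen (@fdeg ds) i.

(* Expressions: a polynomial is a list of terms coefficient * word in the
   variables, an element of freeSeq ds is a list of terms polynomial * basis
   element. No normal form is imposed. *)
Definition pexpr : Type := seq (K * seq var).
Definition fexpr (ds : seq nat) : Type := seq (pexpr * fbasis (@fdeg ds)).

Definition pval (p : pexpr) : pol :=
  \sum_(u <- p) pC u.1 * \prod_(v <- u.2) pX v.

Definition fval ds (e : fexpr ds) : freeSeq ds :=
  \sum_(u <- e) pval u.1 *: (<< 1 *g u.2 >> : free_car (@fdeg ds)).

End IncModules.

(* Algorithms over K: while-programs on binary trees whose leaves are nil or
   field elements. They access field elements only through the field operations
   and the equality test, one elementary step each. *)
Inductive data (K : Type) :=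
| Nil
| Fld of K
| Cons of data K & data K.
Arguments Nil {K}.
Arguments Fld {K} _.
Arguments Cons {K} _ _.

Inductive instr :=
| INil | IId | IHead | ITail | IIsFld
| IZero | IOne | IAdd | IOpp | IMul | IInv | IEq.

(* Booleans: Nil is false, everything else is true. An instruction applied to
   data of the wrong shape returns Nil. *)
Definition dbool (K : Type) (b : bool) : data K := if b then Cons Nil Nil else Nil.

Definition exec (K : fieldType) (o : instr) (x : data K) : data K :=
  match o, x with
  | IId, _ => x
  | IHead, Cons y _ => y
  | ITail, Cons _ y => y
  | IIsFld, Fld _ => dbool K true
  | IZero, _ => Fld 0
  | IOne, _ => Fld 1
  | IAdd, Cons (Fld a) (Fld b) => Fld (a + b)
  | IOpp, Fld a => Fld (- a)
  | IMul, Cons (Fld a) (Fld b) => Fld (a * b)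
  | IInv, Fld a => Fld a^-1
  | IEq, Cons (Fld a) (Fld b) => dbool K (a == b)
  | _, _ => Nil
  end.

Inductive prog :=
| Exec of instr
| Seq of prog & prog
| Pair of prog & prog
| If of prog & prog & prog
| While of prog & prog.

(* run A x y: the program A halts on x, with result y. *)
Inductive run (K : fieldType) : prog -> data K -> data K -> Prop :=
| run_exec o x : run (Exec o) x (exec o x)
| run_seq p q x y z : run p x y -> run q y z -> run (Seq p q) x z
| run_pair p q x y z : run p x y -> run q x z -> run (Pair p q) x (Cons y z)
| run_if_true b p q x t y :
    run b x t -> t <> Nil -> run p x y -> run (If b p q) x y
| run_if_false b p q x y : run b x Nil -> run q x y -> run (If b p q) x y
| run_while_true b p x t y z :
    run b x t -> t <> Nil -> run p x y -> run (While b p) y z ->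
    run (While b p) x z
| run_while_false b p x : run b x Nil -> run (While b p) x x.

Lemma run_det (K : fieldType) A (x y z : data K) :
  run A x y -> run A x z -> y = z.
Proof.
move=> Hy; elim: Hy z => {A x y} [o x|p q x y z _ IH1 _ IH2|p q x y z _ IH1 _ IH2
  |b p q x t y _ IH1 tN _ IH2|b p q x y _ IH1 _ IH2
  |b p x t y z _ IH1 tN _ IH2 _ IH3|b p x _ IH1] w Hw;
  inversion Hw as [|? ? ? y' ? R1 R2|? ? ? y' z' R1 R2|? ? ? ? t' ? R1 N R2
    |? ? ? ? ? R1 R2|? ? ? t' y' ? R1 N R2 R3|? ? ? R1];
  subst => //.
- by move: R2; rewrite -(IH1 _ R1) => /IH2.
- by rewrite (IH1 _ R1) (IH2 _ R2).
- exact: IH2.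
- by case: tN; apply: IH1.
- by case: N; rewrite (IH1 _ R1).
- exact: IH2.
- by move: R3; rewrite -(IH2 _ R2) => /IH3.
- by case: tN; apply: IH1.
- by case: N; rewrite (IH1 _ R1).
Qed.

Section Encoding.
Context (K : fieldType) (c : nat).

Definition enc_nat (n : nat) : data K := iter n (Cons Nil) Nil.

Definition enc_seq (T : Type) (enc : T -> data K) (s : seq T) : data K :=
  foldr (fun x => Cons (enc x)) Nil s.

Definition enc_pair (S T : Type) (encS : S -> data K) (encT : T -> data K)
  (u : S * T) : data K := Cons (encS u.1) (encT u.2).

Definition enc_ord (n : nat) (i : 'I_n) : data K := enc_nat i.

Definition enc_pexpr : pexpr K c -> data K :=
  enc_seq (enc_pair (@Fld K) (enc_seq (enc_pair (@enc_ord c) enc_nat))).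

(* (i, pi) with pi given by the list of its values *)
Definition enc_fbasis (ds : seq nat) (b : fbasis (@fdeg ds)) : data K :=
  Cons (enc_ord (tag b)) (enc_seq enc_nat (codom (val (tagged b)))).

Definition enc_fexpr (ds : seq nat) : fexpr K c ds -> data K :=
  enc_seq (enc_pair enc_pexpr (@enc_fbasis ds)).

Definition enc_input (s : nat) (ds : seq nat) (B : seq (fexpr K c ds)) : data K :=
  Cons (enc_nat s) (Cons (enc_seq enc_nat ds) (enc_seq (@enc_fexpr ds) B)).

(* A sequence F_s -> ... -> F_1 -> F_0 of free modules is given by the list
   Ds = [:: ds_0; ...; ds_s] with F_j = freeSeq ds_j, and by expressions im j i
   for the image in F_j of the i-th generator of F_(j+1). *)
Definition rank_at (Ds : seq (seq nat)) (j : nat) : seq nat := nth [::] Ds j.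

Definition chain_images (Ds : seq (seq nat)) : Type :=
  forall j, 'I_(size (rank_at Ds j.+1)) -> fexpr K c (rank_at Ds j).

(* the list, for j = 1, ..., s, of ds_j and the images of the generators of F_j *)
Definition enc_output (Ds : seq (seq nat)) (im : chain_images Ds) : data K :=
  enc_seq (fun j => Cons (enc_seq enc_nat (rank_at Ds j.+1))
                         (enc_seq (@enc_fexpr _) (codom (im j))))
          (iota 0 (size Ds).-1).

End Encoding.

(* Main.v *)
From HB Require Import structures.
Require Import Defs.
From Stdlib Require Import Classical ClassicalEpsilon.
From mathcomp Require Import all_boot all_order all_algebra.
From mathcomp Require Import finmap zify.
From mathcomp.multinomials Require Import monalg.

(* The algorithm iterates one step: from a finite set B of generators compute, by
   Buchberger's procedure, a finite set G containing the nonzero elements of B,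
   generating the same Inc-submodule, all of whose S-pairs reduce to 0; then
   output the free module on G, an element whose columns are < d getting degree d,
   and continue with the syzygies that the reductions of the S-pairs record.
   - Modulo those syzygies, two terms of the free module on G whose images have the
     same leading monomial differ, up to a scalar, by terms with smaller leading
     monomials. By well-founded induction on the leading monomial they therefore
     generate the kernel; no theory of Groebner bases beyond this is needed.
   - Any two increasing maps from [d] and [d'] factor through a common increasing
     map from [d + d'], so there are only finitely many S-pairs.
   - Monomials are words over N^c with marked letters, and divisibility up to Inc
     is the subword order, so Buchberger's procedure stops by Higman's lemma.
   The procedure runs on lists of terms without any normal form and terminates on
   every such input, hence it is a total function, and total functions built by
   the usual combinators and by terminating loops are computed by programs. *)

Set Implicit Arguments.
Unset Strict Implicit.
Unset Printing Implicit Defensive.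

Import GRing.Theory.
Local Open Scope nat_scope.

(** * Multisets and Higman's lemma *)

(** An element g whose columns all lie below d depends on a map of [Inc] only through its first d
    values. Hence a generator of degree d can be sent to g, and a translate of g is described by a
    finite increasing list p. The pairs (i, p) label both the translates of the elements of G and
    the basis of the free module on G, in the very format used for the basis of the given module. So
    a syzygy is again a list of terms, and one step iterates on a single data type. The main
    obstacle is the gap between lists and module elements: a list may repeat or cancel terms,
    permute variables, or carry a label that names no basis element. Order, leading monomials and
    termination are therefore developed for raw lists, with monomials compared up to permutation.
    Meaning is attached afterwards by [rval]; validity holds for the input and is preserved by each
    step. The remainder of a reduction is not stored but recomputed from the record of the steps,
    and this record, once its remainder has empty support, is the syzygy itself. *)

Lemma sub_count_perm (T : eqType) (s t : seq T) :
  (forall x, count_mem x s <= count_mem x t) -> size t <= size s -> perm_eq s t.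
Proof.
elim: s t => [|x s IH] t le sz.
  by move: sz; rewrite leqn0 size_eq0 => /eqP->.
have xt : x \in t.
  by rewrite -has_pred1 has_count; apply: leq_trans (le x); rewrite /= eqxx.
rewrite perm_sym; apply: perm_trans (perm_to_rem xt) _.
rewrite perm_cons perm_sym; apply: IH; last by rewrite size_rem //; move: sz => /=; lia.
move=> y; move: (le y); rewrite /= (permP (perm_to_rem xt)) /=; lia.
Qed.

(* Multisets are compared at the largest element where they differ, so that
   increasing relabellings preserve the order. *)
Definition mset_lt (s t : seq nat) : bool :=
  has (fun q => (count_mem q s < count_mem q t) &&
    all (fun r => (q < r) ==> (count_mem r s == count_mem r t)) (s ++ t)) t.

Lemma mset_ltP s t : reflect
  (exists q, count_mem q s < count_mem q t /\
     forall r, q < r -> count_mem r s = count_mem r t) (mset_lt s t).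
Proof.
apply: (iffP hasP) => [[q _ /andP[lt /allP eqs]]|[q [lt eqs]]].
  exists q; split=> // r qr.
  have [rst|] := boolP (r \in s ++ t).
    by have := eqs _ rst; rewrite qr /= => /eqP.
  by rewrite mem_cat negb_or => /andP[/count_memPn-> /count_memPn->].
exists q; first by rewrite -has_pred1 has_count; lia.
by rewrite lt; apply/allP => r _; apply/implyP => /eqs/eqP.
Qed.

Lemma mset_lt_irr s : mset_lt s s = false.
Proof. by apply/mset_ltP => -[q []]; rewrite ltnn. Qed.

Lemma mset_lt_trans : transitive mset_lt.
Proof.
move=> t s u /mset_ltP[q [lt eqs]] /mset_ltP[q' [lt' eqs']].
apply/mset_ltP; exists (maxn q q'); split.
  case: (ltngtP q q') => qq.
  - by rewrite (eqs q').
  - by rewrite -(eqs' q).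
  - by subst q'; apply: ltn_trans lt lt'.
by move=> r mr; rewrite eqs ?eqs' //; lia.
Qed.

Lemma mset_lt_perml s s' t : perm_eq s s' -> mset_lt s t = mset_lt s' t.
Proof.
move=> /permP e; apply/mset_ltP/mset_ltP => -[q [lt eqs]]; exists q; split.
- by rewrite -e.
- by move=> r /eqs; rewrite e.
- by rewrite e.
- by move=> r /eqs; rewrite e.
Qed.

Lemma mset_lt_permr s t t' : perm_eq t t' -> mset_lt s t = mset_lt s t'.
Proof.
move=> /permP e; apply/mset_ltP/mset_ltP => -[q [lt eqs]]; exists q; split.
- by rewrite -e.
- by move=> r /eqs; rewrite e.
- by rewrite e.
- by move=> r /eqs; rewrite e.
Qed.

(** The largest element at which the counts differ decides; it exists because elements outside both
    lists have count 0 in each. *)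
Lemma mset_lt_total s t : [|| mset_lt s t, perm_eq s t | mset_lt t s].
Proof.
have [//|npe] := boolP (perm_eq s t); first by rewrite orbT.
pose P q := (count_mem q s != count_mem q t).
have exP : exists q, P q.
  by move: npe; rewrite /perm_eq => /allPn[q _ /= ?]; exists q.
have ubP q : P q -> q <= \max_(x <- s ++ t) x.
  move=> Pq; have: q \in s ++ t.
    rewrite mem_cat; apply: contraR Pq; rewrite negb_or.
    by case/andP => /count_memPn e /count_memPn f; rewrite /P e f.
  by move=> qs; rewrite (big_rem q) //= leq_max leqnn.
case: (ex_maxnP exP ubP) => q Pq maxq.
have eqs r : q < r -> count_mem r s = count_mem r t.
  by move=> qr; apply/eqP; apply: contraTT qr => /maxq; rewrite -leqNgt.
case: (ltngtP (count_mem q s) (count_mem q t)) => c.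
- by apply/orP; left; apply/mset_ltP; exists q.
- apply/orP; right; apply/orP; right; apply/mset_ltP.
  by exists q; split=> // r /eqs.
- by rewrite /P c eqxx in Pq.
Qed.

Lemma mset_lt_cat u s t : mset_lt (u ++ s) (u ++ t) = mset_lt s t.
Proof.
apply/mset_ltP/mset_ltP => -[q [lt eqs]]; exists q; split.
- by move: lt; rewrite !count_cat ltn_add2l.
- by move=> r /eqs; rewrite !count_cat => /addnI.
- by rewrite !count_cat ltn_add2l.
- by move=> r /eqs; rewrite !count_cat => ->.
Qed.

Lemma count_mem_map_inj (T U : eqType) (f : T -> U) (s : seq T) x :
  injective f -> count_mem (f x) (map f s) = count_mem x s.
Proof. by move=> fI; rewrite count_map; apply: eq_count => y /=; rewrite (inj_eq fI). Qed.

Lemma mset_lt_map (f : nat -> nat) s t : {mono f : x y / x < y} ->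
  mset_lt s t -> mset_lt (map f s) (map f t).
Proof.
move=> fm; have fI : injective f.
  by move=> x y e; have := fm x y; have := fm y x; rewrite e ltnn; lia.
move=> /mset_ltP[q [lt eqs]]; apply/mset_ltP; exists (f q).
rewrite !count_mem_map_inj //; split=> // r qr.
have [/mapP[x _ e]|] := boolP (r \in map f (s ++ t)).
  by subst r; rewrite !count_mem_map_inj // eqs // -fm.
by rewrite map_cat mem_cat negb_or => /andP[/count_memPn-> /count_memPn->].
Qed.

(** Nested descent on a bound n for the elements, on the multiplicity of the top element, and on the
    part below it. Passing to a smaller multiset never introduces an element beyond the bound. *)
Lemma mset_lt_wf : well_founded mset_lt.
Proof.
have main n s : all (gtn n) s -> Acc mset_lt s.
  elim: n s => [|n IHn] s.
    by case: s => // _; constructor=> t /mset_ltP[q []]; rewrite ltn0.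
  have [k sk] : exists k, count_mem n s < k by exists (count_mem n s).+1.
  elim: k s sk => [s|k IHk s]; first by rewrite ltn0.
  rewrite ltnS => sk sn.
  pose lo := filter (gtn n) : seq nat -> seq nat.
  have los u : all (gtn n) (lo u) by apply/allP => x; rewrite mem_filter => /andP[].
  move: sk sn; move Es : (lo s) => l; have := IHn _ (los s); rewrite Es => aL.
  elim: aL s Es => {}l _ IHl s Es sk sn.
  constructor=> t /mset_ltP[q [lt eqs]].
  have cs r : n < r -> count_mem r s = 0.
    move=> nr; apply/count_memPn; apply: contraL nr => /(allP sn) /=.
    by rewrite ltnS -leqNgt.
  have qn : q <= n by rewrite leqNgt; apply/negP => /cs e; rewrite e in lt.
  have ct r : n < r -> count_mem r t = 0.
    by move=> nr; rewrite eqs ?cs // (leq_ltn_trans qn).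
  have tn : all (gtn n.+1) t.
    apply/allP => x xt /=; rewrite ltnS leqNgt; apply/negP => /ct/count_memPn.
    by rewrite xt.
  case: (ltngtP (count_mem n t) (count_mem n s)) => c.
  - by apply: IHk => //; apply: leq_trans c sk.
  - have: q < n by rewrite ltn_neqAle qn andbT; apply/eqP => e; subst q; lia.
    by move=> /eqs e; lia.
  - apply: (IHl (lo t)) => //; last by rewrite c.
    rewrite -Es; apply/mset_ltP; exists q.
    have q_n : q < n by rewrite ltn_neqAle qn andbT; apply/eqP => e; subst q; lia.
    have clo r u : count_mem r (lo u) = (r < n) * count_mem r u.
      rewrite /lo count_filter; case: (ltnP r n) => rn.
        rewrite mul1n; apply: eq_count => x /=; case: eqP => // -> ; by rewrite rn.
      rewrite mul0n; apply/eqP; rewrite -leqn0 -(count_pred0 u) sub_count //.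
      by move=> x /= /andP[/eqP-> ]; rewrite ltnNge rn.
    by rewrite !clo q_n !mul1n; split=> // r qr; rewrite !clo eqs.
move=> s; apply: (main (\max_(x <- s) x).+1); apply/allP => x xs /=.
by rewrite ltnS (big_rem x) //= leq_max leqnn.
Qed.

(** * Nondecreasing subsequences *)

Lemma incr_seqP (f : nat -> nat) : (forall n, f n < f n.+1) -> {mono f : x y / x < y}.
Proof.
move=> fS; have h : {homo f : x y / x < y} by apply: homo_ltn => //; apply: ltn_trans.
move=> x y; case: (ltngtP x y) => [/h->//|/h|->]; last by rewrite ltnn.
by rewrite ltnNge => lt; apply/negbTE; rewrite -leqNgt ltnW // ltnNge.
Qed.

Lemma ex_least (P : nat -> Prop) : (exists n, P n) ->
  exists n, P n /\ forall m, P m -> n <= m.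
Proof.
case=> n; elim/ltn_ind: n => n IH Pn.
case: (classic (exists m, m < n /\ P m)) => [[m [mn Pm]]|no]; first exact: IH Pm.
exists n; split=> // m Pm; rewrite leqNgt; apply/negP => mn.
by apply: no; exists m.
Qed.

(** Each chosen index minimises [f] over all indices from some point on, so no later value can be
    smaller. *)
Lemma nondecreasing_subseq_nat (f : nat -> nat) : exists g : nat -> nat,
  (forall n, g n < g n.+1) /\ (forall a b, a < b -> f (g a) <= f (g b)).
Proof.
have arg N : exists n, N <= n /\ forall m, N <= m -> f n <= f m.
  have [|v [[n [Nn <-]] mn]] := @ex_least (fun v => exists n, N <= n /\ f n = v).
    by exists (f N), N.
  by exists n; split=> // m Nm; apply: mn; exists m.
pose nx N := proj1_sig (constructive_indefinite_description _ (arg N)).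
have nxP N : N <= nx N /\ forall m, N <= m -> f (nx N) <= f m.
  exact: proj2_sig (constructive_indefinite_description _ (arg N)).
pose g := fix g n := if n is n'.+1 then nx (g n').+1 else nx 0.
have gS n : g n < g n.+1 by case: (nxP (g n).+1).
exists g; split=> // a b ab.
have gab : g a <= g b by rewrite ltnW // incr_seqP.
case: a ab gab => [|a] ab gab; first by case: (nxP 0) => _; apply.
case: (nxP (g a).+1) => l; apply; apply: leq_trans gab.
by case: (nxP (g a).+1).
Qed.

(** Dickson's argument: a subsequence good for some functions stays good when it is thinned out for
    one more. *)
Lemma nondecreasing_subseq (fs : seq (nat -> nat)) : exists g : nat -> nat,
  (forall n, g n < g n.+1) /\
  (forall f, List.In f fs -> forall a b, a < b -> f (g a) <= f (g b)).
Proof.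
elim: fs => [|f fs [g [gS gm]]]; first by exists id.
have [h [hS hm]] := nondecreasing_subseq_nat (f \o g).
exists (g \o h); split=> [n|f' [<-|f'fs] a b ab] /=; first by rewrite incr_seqP.
  exact: hm.
by apply: gm => //; rewrite incr_seqP.
Qed.

(** * Subword embeddings and minimal bad sequences *)

Section Higman.
Variables (T : Type) (R : T -> T -> Prop).

Inductive emb : seq T -> seq T -> Prop :=
| emb_nil v : emb [::] v
| emb_skip u y v : emb u v -> emb u (y :: v)
| emb_cons x u y v : R x y -> emb u v -> emb (x :: u) (y :: v).

(** Turns an embedding of words into an explicit increasing list, which later serves as the map p of
    a reducer. *)
Lemma emb_positions u v : emb u v -> exists p : seq nat,
  [/\ sorted ltn p, size p = size u, all (gtn (size v)) p
    & forall x0 k, k < size u -> R (nth x0 u k) (nth x0 v (nth 0 p k))].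
Proof.
have srt p : sorted ltn p -> sorted ltn (map S p).
  by rewrite sorted_map (eq_sorted (e' := ltn)).
elim=> {u v} [v|u y v _ [p [ps sp pv Rp]]|x u y v Rxy _ [p [ps sp pv Rp]]].
- by exists [::].
- exists (map S p); split; rewrite ?size_map ?srt //; first by rewrite all_map.
  by move=> x0 k ku; rewrite (nth_map 0) ?sp //=; apply: Rp.
- exists (0 :: map S p); split.
  + rewrite /= path_min_sorted ?srt //; apply/allP => _ /mapP[z _ ->] //.
  + by rewrite /= size_map sp.
  + by rewrite /= all_map.
  + by move=> x0 [|k] //= ku; rewrite (nth_map 0) ?sp //=; apply: Rp.
Qed.

(** A well-quasi-order in its subsequence form: the minimal bad sequence is thinned out until its
    first letters increase. *)
Hypothesis R_subseq : forall f : nat -> T, exists g : nat -> nat,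
  (forall n, g n < g n.+1) /\ (forall a b, a < b -> R (f (g a)) (f (g b))).

Let bad (F : nat -> seq T) := forall a b, a < b -> ~ emb (F a) (F b).
Let agree n (F F' : nat -> seq T) := forall i, i < n -> F' i = F i.

Lemma minimal_bad_ext n F : bad F -> exists F', [/\ bad F', agree n F F' &
  forall F'', bad F'' -> agree n F F'' -> size (F' n) <= size (F'' n)].
Proof.
move=> bF; have [|v [[F' [bF' aF' <-]] mn]] :=
  @ex_least (fun v => exists F', [/\ bad F', agree n F F' & size (F' n) = v]).
  by exists (size (F n)), F; split.
by exists F'; split=> // F'' bF'' aF''; apply: mn; exists F''.
Qed.

(* Nash-Williams: a bad sequence minimal in each entry loses its first letters. *)
Theorem higman (F : nat -> seq T) : exists a b, a < b /\ emb (F a) (F b).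
Proof.
apply: NNPP => nF; have bF : bad F by move=> a b ab e; apply: nF; exists a, b.
pose nx n (X : {F | bad F}) : {F' | bad F'} :=
  let c := constructive_indefinite_description _ (minimal_bad_ext n (proj2_sig X)) in
  exist _ (proj1_sig c) (let: And3 b _ _ := proj2_sig c in b).
have nxa n X : agree n (sval X) (sval (nx n X)).
  by rewrite /nx /=; case: (constructive_indefinite_description _ _) => F' [].
have nxm n X F'' : bad F'' -> agree n (sval X) F'' ->
    size (sval (nx n X) n) <= size (F'' n).
  by rewrite /nx /=; case: (constructive_indefinite_description _ _) => F' [] /=; auto.
(* Stage n makes entry n as short as possible and leaves the earlier entries alone; [g] is the
   diagonal. *)
pose S := fix S n := if n is n'.+1 then nx n (S n') else nx 0 (exist _ F bF).
pose g n := sval (S n) n.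
have Sg m i : i <= m -> sval (S m) i = g i.
  elim: m => [|m IH]; first by rewrite leqn0 => /eqP->.
  rewrite leq_eqVlt => /orP[/eqP->//|im]; rewrite -IH //.
  exact: (nxa m.+1 (S m)).
have bg : bad g.
  by move=> a b ab; rewrite -(Sg b a) ?(ltnW ab) //; apply: (proj2_sig (S b)).
have gm n h : bad h -> agree n g h -> size (g n) <= size (h n).
  move=> bh ah; rewrite /g; case: n ah => [|n] ah; first exact: nxm.
  by apply: nxm => // i iN; rewrite ah // Sg.
have gne n : g n <> [::] by move=> e; apply: (bg n n.+1) => //; rewrite e; constructor.
have [x0 _] : exists x0 : T, True by case: (g 0) (gne 0) => // x; exists x.
have [k [kS Rk]] := R_subseq (fun n => head x0 (g n)).
have gE n : g n = head x0 (g n) :: behead (g n) by case: (g n) (gne n).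
(* First letters are dropped along the good subsequence [k], and [g] is kept before [k 0]. An
   embedding between tails would extend to one in [g], so [h] is bad, yet it is shorter than [g] at
   entry [k 0]. *)
pose h n := if n < k 0 then g n else behead (g (k (n - k 0))).
have bh : bad h.
  have skip u n : emb u (behead (g n)) -> emb u (g n) by rewrite {2}gE; constructor.
  have k0 n : k 0 <= k n by rewrite leqNgt incr_seqP.
  move=> a b ab; rewrite /h; case: (ltnP a (k 0)) => ak; case: (ltnP b (k 0)) => bk.
  - exact: bg.
  - by move=> /skip; apply: bg; apply: leq_trans ak (k0 _).
  - by have := leq_ltn_trans ak (ltn_trans ab bk); rewrite ltnn.
  - have lt : a - k 0 < b - k 0 by lia.
    move=> e; apply: (bg (k (a - k 0)) (k (b - k 0))); first by rewrite incr_seqP.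
    by rewrite gE (gE (k (b - k 0))); constructor=> //; apply: Rk.
have := gm (k 0) h bh; rewrite {2}/h ltnn subnn.
have -> : size (g (k 0)) = (size (behead (g (k 0)))).+1 by rewrite {1}gE.
by rewrite ltnn => /(_ _)/notF; apply=> i ik; rewrite /h ik.
Qed.

End Higman.

(** * Monomials *)

Lemma Inc_inj (t : Inc) : injective t.
Proof.
by move=> x y e; case: (ltngtP x y) => // /(@Inc_mono t _ _); rewrite e ltnn.
Qed.

Lemma Inc_lt (t : Inc) : {mono t : x y / x < y}.
Proof.
move=> x y; case: (ltngtP x y) => [/(@Inc_mono t _ _)->//|/(@Inc_mono t _ _) lt|->].
  by apply/negbTE; rewrite -leqNgt ltnW.
by rewrite ltnn.
Qed.

(** Programs handle finite lists of values, while the action needs a map on all columns; past the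
    list the values continue beyond its last entry. *)
Lemma Inc_extend (u : seq nat) : sorted ltn u ->
  exists t : Inc, forall j, j < size u -> t j = nth 0 u j.
Proof.
move=> su; pose f j := if j < size u then nth 0 u j else (last 0 u).+1 + j.
have fm : {homo f : i j / i < j}.
  move=> i j ij; rewrite /f; case: (ltnP j (size u)) => ju.
    by rewrite (ltn_trans ij ju); apply: (sorted_ltn_nth ltn_trans 0 su) => //; rewrite inE (ltn_trans ij).
  case: (ltnP i (size u)) => iu; last by rewrite ltn_add2l.
  have: nth 0 u i <= last 0 u; last by lia.
  rewrite -nth_last; have : i <= (size u).-1 by lia.
  rewrite leq_eqVlt => /orP[/eqP->//|il]; apply: ltnW.
  by apply: (sorted_ltn_nth ltn_trans 0 su) => //; rewrite inE; lia.
by exists (MkInc fm) => j ju; rewrite /= /f ju.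
Qed.

Section Monomials.
Context (c : nat).
Local Notation V := ('I_c * nat)%type.

(* (vs, (i, rho)) stands for the monomial with variables vs times the basis
   element of the i-th summand with values rho. *)
Definition mono : Type := (seq V * (nat * seq nat))%type.

(** Column-major numbering: the column decides and the row breaks ties, so moving columns by an
    increasing map keeps the order of indices. *)
Definition vidx (v : V) : nat := v.2 * c + v.1.

Lemma vidx_inj : injective vidx.
Proof.
move=> [i j] [i' j'] e; have c0 : 0 < c by case: (c) i {i' e} => // -[].
have: vidx (i, j) %/ c = vidx (i', j') %/ c by rewrite e.
rewrite /vidx !divnMDl // !divn_small // !addn0 => /= ej; subst j'.
by congr (_, _); apply/val_inj; move: e; rewrite /vidx /=; lia.
Qed.

(** Marks of a basis element are sorted, but those of a raw monomial may not be; comparing them as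
    multisets makes [ltm] total up to [eqm] on all raw monomials. *)
Definition eqm (m m' : mono) : bool :=
  [&& m.2.1 == m'.2.1, perm_eq m.2.2 m'.2.2 & perm_eq m.1 m'.1].

(** A position-over-term order: summand, then basis element, then variables. In [mset_lt] one large
    index outweighs any number of smaller ones, which keeps the order well-founded despite
    infinitely many variables. *)
Definition ltm (m m' : mono) : bool :=
  (m.2.1 < m'.2.1) || (m.2.1 == m'.2.1) &&
  (mset_lt m.2.2 m'.2.2 ||
   perm_eq m.2.2 m'.2.2 && mset_lt (map vidx m.1) (map vidx m'.1)).

Definition act (t : nat -> nat) (m : mono) : mono :=
  ([seq (v.1, t v.2) | v <- m.1], (m.2.1, map t m.2.2)).

Definition mulm (b : seq V) (m : mono) : mono := (b ++ m.1, m.2).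

Definition cols (m : mono) : seq nat := map snd m.1 ++ m.2.2.

Lemma eqm_refl : reflexive eqm.
Proof. by move=> m; rewrite /eqm eqxx !perm_refl. Qed.

Lemma eqm_sym : symmetric eqm.
Proof. by move=> m m'; rewrite /eqm eq_sym perm_sym [perm_eq m.1 _]perm_sym. Qed.

Lemma eqm_trans : transitive eqm.
Proof.
move=> m m' m'' /and3P[/eqP e1 e2 e3] /and3P[/eqP e1' e2' e3'].
by rewrite /eqm e1 e1' eqxx (perm_trans e2) // (perm_trans e3).
Qed.

Lemma eqm_ltml m1 m2 m : eqm m1 m2 -> ltm m1 m = ltm m2 m.
Proof.
case/and3P => /eqP e1 e2 e3; rewrite /ltm e1 (mset_lt_perml _ e2).
by rewrite (permPl e2) (mset_lt_perml _ (perm_map vidx e3)).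
Qed.

Lemma eqm_ltmr m1 m2 m : eqm m1 m2 -> ltm m m1 = ltm m m2.
Proof.
case/and3P => /eqP e1 e2 e3; rewrite /ltm e1 (mset_lt_permr _ e2).
by rewrite (permPr e2) (mset_lt_permr _ (perm_map vidx e3)).
Qed.

Lemma eqml m1 m2 m : eqm m1 m2 -> eqm m1 m = eqm m2 m.
Proof.
by move=> e; apply/idP/idP => h; apply: eqm_trans h => //; rewrite eqm_sym.
Qed.

Lemma eqmr m1 m2 m : eqm m1 m2 -> eqm m m1 = eqm m m2.
Proof. by move=> e; rewrite ![eqm m _]eqm_sym (eqml _ e). Qed.

Lemma ltm_irr m : ltm m m = false.
Proof. by rewrite /ltm ltnn !mset_lt_irr andbF andbF. Qed.

Lemma ltm_trans : transitive ltm.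
Proof.
move=> m2 m1 m3; rewrite /ltm.
case/orP => [l1|/andP[/eqP e1 h1]]; case/orP => [l2|/andP[/eqP e2 h2]].
- by rewrite (ltn_trans l1 l2).
- by rewrite -e2 l1.
- by rewrite e1 l2.
rewrite e1 e2 eqxx; apply/orP; right => /=.
case/orP: h1 => [l1|/andP[p1 l1]]; case/orP: h2 => [l2|/andP[p2 l2]].
- by rewrite (mset_lt_trans l1 l2).
- by rewrite -(mset_lt_permr _ p2) l1.
- by rewrite (mset_lt_perml _ p1) l2.
- by rewrite (perm_trans p1 p2) (mset_lt_trans l1 l2) orbT.
Qed.

Lemma ltm_total m m' : [|| ltm m m', eqm m m' | ltm m' m].
Proof.
rewrite /ltm /eqm [m'.2.1 == _]eq_sym [perm_eq m'.2.2 _]perm_sym.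
case: (ltngtP m.2.1 m'.2.1) => //= _.
have := mset_lt_total m.2.2 m'.2.2.
case: (mset_lt m.2.2 _) => //=; case: (perm_eq m.2.2 _) => /=; last by move=> ->.
move=> _; have := mset_lt_total (map vidx m.1) (map vidx m'.1).
case: (mset_lt (map vidx m.1) _) => //= /orP[/(perm_map_inj vidx_inj)->//|->].
by rewrite !orbT.
Qed.

Lemma ltm_wf : well_founded ltm.
Proof.
suff main i : forall r, Acc mset_lt r -> forall s, Acc mset_lt s ->
    forall m, m.2.1 = i -> perm_eq m.2.2 r -> perm_eq (map vidx m.1) s -> Acc ltm m.
  move=> m; exact: (main m.2.1 m.2.2 (mset_lt_wf _) (map vidx m.1) (mset_lt_wf _)).
elim/ltn_ind: i => i IHi r; elim=> {}r _ IHr s; elim=> {}s _ IHs m mi mr ms.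
constructor=> m'; rewrite /ltm mi => /orP[lt|/andP[/eqP e]].
  exact: (IHi _ lt m'.2.2 (mset_lt_wf _) (map vidx m'.1) (mset_lt_wf _)).
case/orP => [lt|/andP[p lt]].
  apply: (IHr m'.2.2 _ (map vidx m'.1) (mset_lt_wf _)) e _ _.
  - by rewrite -(mset_lt_permr _ mr).
  - exact: perm_refl.
  - exact: perm_refl.
apply: (IHs (map vidx m'.1)) e _ _.
- by rewrite -(mset_lt_permr _ ms).
- exact: perm_trans mr.
- exact: perm_refl.
Qed.

Lemma act_eq_in t t' m : {in cols m, t =1 t'} -> act t m = act t' m.
Proof.
move=> e; rewrite /act; congr (_, (_, _)); apply/eq_in_map => x xm.
  by rewrite e // mem_cat map_f.
by rewrite e // mem_cat xm orbT.
Qed.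

Lemma act_comp t t' m : act (t \o t') m = act t (act t' m).
Proof. by rewrite /act /= -!map_comp. Qed.

Lemma act_mulm t b m : act t (mulm b m) = mulm [seq (v.1, t v.2) | v <- b] (act t m).
Proof. by rewrite /act /mulm /= map_cat. Qed.

Lemma act_var_inj (t : Inc) : injective (fun v : V => (v.1, t v.2)).
Proof. by move=> [i j] [i' j'] [-> /Inc_inj->]. Qed.

Lemma eqm_act (t : Inc) m m' : eqm (act t m) (act t m') = eqm m m'.
Proof.
rewrite /eqm /=; congr [&& _, _ & _].
  by apply/idP/idP => [/(perm_map_inj (@Inc_inj t))|/perm_map->].
by apply/idP/idP => [/(perm_map_inj (@act_var_inj t))|/perm_map->].
Qed.

Lemma eqm_mulm b m m' : eqm (mulm b m) (mulm b m') = eqm m m'.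
Proof. by rewrite /eqm /= perm_cat2l. Qed.

Lemma eqm_mulml b b' m : perm_eq b b' -> eqm (mulm b m) (mulm b' m).
Proof. by move=> e; rewrite /eqm /= eqxx perm_refl perm_cat2r. Qed.

(** The relabelling acts on variables rather than on their indices, so [mset_lt_map] covers only the
    marks. For the variables, [lt_vidx] compares columns first, and [t] preserves that
    comparison. *)
Lemma ltm_act (t : Inc) m m' : ltm m m' -> ltm (act t m) (act t m').
Proof.
rewrite /ltm /= => /orP[->//|/andP[-> h]]; apply/orP; right.
case/orP: h => [lt|/andP[p lt]]; first by rewrite mset_lt_map //; apply: Inc_lt.
apply/orP; right; rewrite perm_map //=.
case/mset_ltP: lt => q [lt eqs]; have: q \in map vidx m'.1.
  by rewrite -has_pred1 has_count; apply: leq_trans lt.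
case/mapP => -[i j] _ eq; pose tv (v : V) : V := (v.1, t v.2).
have tE l : map vidx [seq (v.1, t v.2) | v <- l] = [seq vidx (tv v) | v <- l].
  by rewrite -map_comp.
have tvI : injective tv by apply: act_var_inj.
have cE l v : count_mem (vidx v) (map vidx l) = count_mem v l.
  exact: count_mem_map_inj vidx_inj.
have ctE l v : count_mem (vidx (tv v)) [seq vidx (tv v) | v <- l] = count_mem v l.
  exact: (count_mem_map_inj _ _ (inj_comp vidx_inj tvI)).
have lt_vidx v w : (vidx v < vidx w) = (v.2 < w.2) || (v.2 == w.2) && (v.1 < w.1).
  case: v w => [i1 j1] [i2 j2] /=; rewrite /vidx /=.
  have := ltn_ord i1; have := ltn_ord i2; case: (ltngtP j1 j2) => h l1 l2 /=.
  - by apply: (@leq_trans (j1.+1 * c)); [lia|apply: (@leq_trans (j2 * c)); [rewrite leq_mul2r h orbT|lia]].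
  - apply/negbTE; rewrite -leqNgt.
    by apply: (@leq_trans (j2.+1 * c)); [lia|apply: (@leq_trans (j1 * c)); [rewrite leq_mul2r h orbT|lia]].
  - by rewrite h ltn_add2l.
apply/mset_ltP; exists (vidx (tv (i, j))); rewrite !tE !ctE.
split=> [|r qr]; first by rewrite -!cE -eq.
have [/mapP[v vs e]|] := boolP (r \in [seq vidx (tv v) | v <- m.1 ++ m'.1]).
  subst r; rewrite !ctE -!cE; apply: eqs; rewrite eq.
  by move: qr; rewrite !lt_vidx /= Inc_lt (inj_eq (@Inc_inj t)).
by rewrite map_cat mem_cat negb_or => /andP[/count_memPn-> /count_memPn->].
Qed.

Lemma ltm_mulm b m m' : ltm m m' -> ltm (mulm b m) (mulm b m').
Proof. by rewrite /ltm /= !map_cat mset_lt_cat. Qed.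

End Monomials.

(** Truncated difference: for variable lists s and t it is the cofactor lcm(s, t)/t. *)
Definition mset_diff (T : eqType) (s t : seq T) : seq T :=
  flatten [seq nseq (count_mem v s - count_mem v t) v | v <- undup s].

Lemma count_mset_diff (T : eqType) (s t : seq T) x :
  count_mem x (mset_diff s t) = count_mem x s - count_mem x t.
Proof.
rewrite /mset_diff count_flatten -map_comp.
rewrite (eq_map (g := fun v => (count_mem v s - count_mem v t) * (v == x))); last first.
  by move=> v /=; rewrite count_nseq /= mulnC.
rewrite sumnE big_map.
have [xs|xs] := boolP (x \in undup s).
  rewrite (big_rem x) //= eqxx muln1 big_seq big1 ?addn0 // => v.
  rewrite mem_rem_uniq ?undup_uniq // inE => /andP[/negbTE->].
  by rewrite muln0.
rewrite big_seq big1; last first.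
  by move=> v vs; case: eqP => [e|]; rewrite ?muln0 //; move: xs; rewrite -e vs.
by move: xs; rewrite mem_undup => /count_memPn->.
Qed.

Lemma perm_mset_diff (T : eqType) (s t : seq T) :
  (forall x, count_mem x t <= count_mem x s) -> perm_eq (mset_diff s t ++ t) s.
Proof.
move=> le; apply/allP => x _ /=.
by rewrite count_cat count_mset_diff subnK.
Qed.

Local Open Scope ring_scope.

(** * Buchberger's procedure *)

Section Raw.
Context (K : fieldType) (c : nat).
Local Notation V := ('I_c * nat)%type.
Local Notation mono := (mono c).

Definition term : Type := (K * mono)%type.

Implicit Types (f g : seq term) (n t : term) (m : mono) (G : seq (seq term)).

Definition rcoef f m : K :=
  foldr (fun t a => if eqm t.2 m then t.1 + a else a) 0 f.

Definition supp f : seq mono := [seq t.2 | t <- f & rcoef f t.2 != 0].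

Definition mono1 : mono := ([::], (0%N, [::])).

Definition lm f : mono :=
  head mono1 [seq m <- supp f | all (fun m' => ~~ ltm m m') (supp f)].

Definition lc f : K := rcoef f (lm f).

(** Columns are read off all listed terms, cancelled ones included: any strict bound on the columns
    of an element can serve as the degree of its generator. *)
Definition width f : nat :=
  foldr maxn 0%N [seq j.+1 | j <- flatten [seq cols t.2 | t <- f]].

Definition subseqs (s : seq nat) : seq (seq nat) :=
  foldr (fun x acc => acc ++ map (cons x) acc) [:: [::]] s.

(* Hom_OI(d, w), maps being given by the list of their values *)
Definition incs (d w : nat) : seq (seq nat) :=
  [seq p <- subseqs (iota 0 w) | size p == d].

(* A term n = (k, (b, (i, p))) of the free module with one generator for each
   element of G is sent to k * b * p.g_i; app G n is its image and, up to a
   scalar, lam G n.2 is the leading monomial of this image. *)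
Definition app G n : seq term :=
  [seq (n.1 * t.1, mulm n.2.1 (act (nth 0%N n.2.2.2) t.2)) | t <- nth [::] G n.2.2.1].

Definition appL G (y : seq term) : seq term := flatten [seq app G n | n <- y].

Definition lam G m : mono := mulm m.1 (act (nth 0%N m.2.2) (lm (nth [::] G m.2.1))).

(* In a state (G, y) the remainder is appL G y, so that y records the reduction. *)
Definition reducer G f (i : nat) (p : seq nat) : term :=
  (- (lc f / lc (nth [::] G i)),
   (mset_diff (lm f).1 (act (nth 0%N p) (lm (nth [::] G i))).1, (i, p))).

(** Since [mset_diff] truncates, cofactor times translated leading monomial gives back [lm f]
    exactly when divisibility holds. The filter on [lam] is thus the divisibility test, and it also
    compares summand and marks. *)
Definition reducers G f : seq term :=
  if nilp (supp f) then [::] else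
  [seq n <- flatten [seq [seq reducer G f i p | p <- incs (width (nth [::] G i)) (width f)]
                    | i <- iota 0 (size G)]
  | ~~ nilp (supp (nth [::] G n.2.2.1)) && eqm (lam G n.2) (lm f)].

Definition reducible (st : seq (seq term) * seq term) : bool :=
  ~~ nilp (reducers st.1 (appL st.1 st.2)).

Definition reduce_step (st : seq (seq term) * seq term) : seq (seq term) * seq term :=
  (st.1, head (0, mono1) (reducers st.1 (appL st.1 st.2)) :: st.2).

(* Two increasing maps from [d] and [d'] factor through [d + d']; hence the maps
   p and q of an S-pair may be taken with values below that bound. *)
Definition spair G (i j : nat) (p q : seq nat) : seq term :=
  let m := act (nth 0%N p) (lm (nth [::] G i)) in
  let m' := act (nth 0%N q) (lm (nth [::] G j)) in
  [:: ((lc (nth [::] G i))^-1, (mset_diff m'.1 m.1, (i, p)));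
      (- (lc (nth [::] G j))^-1, (mset_diff m.1 m'.1, (j, q)))].

(** The cofactors already make the variables agree, so the filter on [lam] discards only the pairs
    with different summand or marks. *)
Definition spairs G : seq (seq term) :=
  [seq y <- flatten [seq flatten [seq flatten [seq [seq spair G i j p q
    | q <- incs (width (nth [::] G j)) (width (nth [::] G i) + width (nth [::] G j))]
    | p <- incs (width (nth [::] G i)) (width (nth [::] G i) + width (nth [::] G j))]
    | j <- iota 0 (size G)] | i <- iota 0 (size G)]
  | eqm (lam G (nth (0, mono1) y 0).2) (lam G (nth (0, mono1) y 1).2)].

(** * Coefficients, leading monomials and translates of lists *)

Lemma rcoefE f m : rcoef f m = \sum_(t <- f | eqm t.2 m) t.1.
Proof. by elim: f => [|t f IH]; rewrite ?big_nil // big_cons /= IH. Qed.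

Lemma rcoef_cat f g m : rcoef (f ++ g) m = rcoef f m + rcoef g m.
Proof. by rewrite !rcoefE big_cat. Qed.

Lemma eqm_rcoef f m m' : eqm m m' -> rcoef f m = rcoef f m'.
Proof. by move=> e; rewrite !rcoefE; apply: eq_bigl => t; rewrite (eqmr _ e). Qed.

Lemma rcoef_appL_cons G n y m : rcoef (appL G (n :: y)) m = rcoef (app G n) m + rcoef (appL G y) m.
Proof. by rewrite rcoef_cat. Qed.

Lemma suppP f m : rcoef f m != 0 -> exists2 m', m' \in supp f & eqm m m'.
Proof.
move=> nz; have [/hasP[t tf e]|/hasPn no] := boolP (has (fun t => eqm t.2 m) f).
  exists t.2; last by rewrite eqm_sym.
  by apply/mapP; exists t; rewrite // mem_filter tf (eqm_rcoef _ e) nz.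
by move: nz; rewrite rcoefE big_seq_cond big1 ?eqxx // => t /andP[/no/negbTE->].
Qed.

Lemma mem_supp f m : m \in supp f -> rcoef f m != 0 /\ exists2 t, t \in f & m = t.2.
Proof. by case/mapP => t; rewrite mem_filter => /andP[nz tf] ->; split=> //; exists t. Qed.

Lemma ltm_maximal (s : seq mono) m0 : m0 \in s ->
  exists2 m, m \in s & all (fun m' => ~~ ltm m m') s.
Proof.
elim: s m0 => // m s IH m0 _; case: s IH => [|m1 s] IH.
  by exists m; rewrite ?mem_head //= ltm_irr.
have [|m' m's /allP max] := IH m1; first exact: mem_head.
have [lt|nlt] := boolP (ltm m' m).
  exists m; first exact: mem_head.
  apply/allP => x; rewrite inE => /orP[/eqP->|xs]; first by rewrite ltm_irr.
  by move: (max x xs); apply: contra; apply: ltm_trans.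
exists m'; first by rewrite inE m's orbT.
by apply/allP => x; rewrite inE => /orP[/eqP->|/max].
Qed.

Lemma lmP f : supp f != [::] ->
  lm f \in supp f /\ forall m, rcoef f m != 0 -> eqm m (lm f) || ltm m (lm f).
Proof.
move=> nz; have [m0 m0s] : exists m0, m0 \in supp f.
  by case: (supp f) nz => // m s _; exists m; rewrite mem_head.
have [m ms max] := ltm_maximal m0s.
have: lm f \in [seq m <- supp f | all (fun m' => ~~ ltm m m') (supp f)].
  rewrite /lm; have: m \in [seq m <- supp f | all (fun m' => ~~ ltm m m') (supp f)].
    by rewrite mem_filter max ms.
  by case: [seq m <- _ | _] => // ? ? _; rewrite mem_head.
rewrite mem_filter => /andP[/allP lmax lms]; split=> // m1 /suppP[m2 m2s e].
have := ltm_total m1 (lm f); have := lmax _ m2s.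
by rewrite -(eqm_ltmr _ e) => /negbTE->; rewrite orbF orbC.
Qed.

Lemma lc_neq0 f : supp f != [::] -> lc f != 0.
Proof. by case/lmP => /mem_supp[]. Qed.

Lemma supp_nil f : supp f = [::] -> forall m, rcoef f m = 0.
Proof. by move=> e m; apply/eqP; case: eqP => // /eqP/suppP[m']; rewrite e. Qed.

Lemma leq_foldr_maxn (s : seq nat) x : x \in s -> (x <= foldr maxn 0 s)%N.
Proof.
by elim: s => //= y s IH; rewrite inE leq_max => /orP[/eqP->|/IH->]; rewrite ?leqnn ?orbT.
Qed.

Lemma cols_width f t j : t \in f -> j \in cols t.2 -> (j < width f)%N.
Proof.
move=> tf jt; apply: leq_foldr_maxn; apply: map_f; apply/flattenP.
by exists (cols t.2) => //; apply: map_f.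
Qed.

Lemma mem_subseqs s p : (p \in subseqs s) = subseq p s.
Proof.
elim: s p => [|x s IH] p; first by rewrite inE; case: p.
rewrite /= mem_cat IH; case: p => [|y p]; first by rewrite sub0seq.
case: eqP => [->|ne].
  rewrite mem_map; last by move=> ? ? [].
  rewrite IH orb_idl //; apply: subseq_trans; exact: subseq_cons.
by rewrite orb_idr // => /mapP[q _ [yx _]]; case: ne.
Qed.

Lemma mem_incs d w p : (p \in incs d w) =
  [&& sorted ltn p, size p == d & all (gtn w) p].
Proof.
rewrite mem_filter mem_subseqs andbC [RHS]andbCA [RHS]andbC.
case: (size p == d); rewrite ?andbF // !andbT.
apply/idP/andP => [sub|[sp /allP pw]].
  split; first by apply: subseq_sorted sub (iota_ltn_sorted _ _); apply: ltn_trans.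
  by apply/allP => x /(mem_subseq sub); rewrite mem_iota.
have -> : p = [seq x <- iota 0 w | x \in p]; last exact: filter_subseq.
apply: (irr_sorted_eq ltn_trans ltnn) => //.
  by apply: sorted_filter (iota_ltn_sorted _ _); apply: ltn_trans.
by move=> x; rewrite mem_filter mem_iota /= add0n; case: (boolP (x \in p)) => // /pw /= ->.
Qed.

(* m is a monomial of the free module on G, an element g having degree width g. *)
Definition gterm G (m : mono) : bool :=
  [&& m.2.1 < size G, sorted ltn m.2.2 & size m.2.2 == width (nth [::] G m.2.1)]%N.

(** The columns of the element stay below the length of the list, so a map of [Inc] extending the
    list acts in the same way; this makes the order lemmas for [Inc] applicable. *)
Lemma gterm_Inc G m : gterm G m -> exists t : Inc,
  [/\ m.2.2 = [seq t j | j <- iota 0 (width (nth [::] G m.2.1))],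
      forall k, app G (k, m) = [seq (k * u.1, mulm m.1 (act t u.2)) | u <- nth [::] G m.2.1]
    & supp (nth [::] G m.2.1) != [::] ->
      lam G m = mulm m.1 (act t (lm (nth [::] G m.2.1)))].
Proof.
case/and3P => iG sp /eqP szp; have [t tE] := Inc_extend sp; exists t.
have eqin u : u \in nth [::] G m.2.1 -> act (nth 0%N m.2.2) u.2 = act t u.2.
  by move=> uG; apply: act_eq_in => j /(cols_width uG); rewrite -szp => /tE->.
split=> [|k|nz].
- apply: (@eq_from_nth _ 0%N) => [|j jp]; first by rewrite size_map size_iota.
  by rewrite (nth_map 0%N) ?size_iota -?szp // nth_iota // tE.
- by rewrite /app /=; apply/eq_in_map => u /eqin->.
- rewrite /lam; have [/mem_supp[_ [u uG ->]] _] := lmP nz.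
  by rewrite eqin.
Qed.

Lemma rcoef_app G m k (t : Inc) :
  app G (k, m) = [seq (k * u.1, mulm m.1 (act t u.2)) | u <- nth [::] G m.2.1] ->
  forall m', rcoef (app G (k, m)) (mulm m.1 (act t m')) = k * rcoef (nth [::] G m.2.1) m'.
Proof.
move=> -> m'; rewrite !rcoefE big_map mulr_sumr; apply: eq_big => u //=.
by rewrite eqm_mulm eqm_act.
Qed.

Lemma app_lam G m k : gterm G m -> supp (nth [::] G m.2.1) != [::] ->
  rcoef (app G (k, m)) (lam G m) = k * lc (nth [::] G m.2.1) /\
  forall m', rcoef (app G (k, m)) m' != 0 -> eqm m' (lam G m) || ltm m' (lam G m).
Proof.
move=> gm nz; have [t [_ aE /(_ nz) ->]] := gterm_Inc gm.
split=> [|m' /suppP[m1]]; first by rewrite (rcoef_app (aE k)).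
case/mem_supp => nz1 [u]; rewrite aE => /mapP[v vG ->] em e.
move: nz1; rewrite em /= (rcoef_app (aE k)) mulf_eq0 negb_or => /andP[_ nzv].
rewrite (eqml _ e) (eqm_ltml _ e) em /= eqm_mulm eqm_act.
have [_ /(_ _ nzv) /orP[->//|lt]] := lmP nz.
by rewrite ltm_mulm ?orbT // ltm_act.
Qed.

Lemma reducersP G f n : n \in reducers G f ->
  [/\ supp f != [::], supp (nth [::] G n.2.2.1) != [::], gterm G n.2,
      eqm (lam G n.2) (lm f) & n.1 = - (lc f / lc (nth [::] G n.2.2.1))].
Proof.
rewrite /reducers; case: nilP => // /eqP nzf; rewrite mem_filter => /andP[/andP[/nilP/eqP nz e]].
case/flatten_mapP => i; rewrite mem_iota /= add0n => iG /mapP[p].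
rewrite mem_incs => /and3P[sp szp pw] en; rewrite en /= in nz e *.
by split=> //; apply/and3P.
Qed.

Lemma eqm_mulm_diff (m m' : mono) : m.2.1 = m'.2.1 -> perm_eq m.2.2 m'.2.2 ->
  (forall v, count_mem v m.1 <= count_mem v m'.1)%N ->
  eqm (mulm (mset_diff m'.1 m.1) m) m'.
Proof. by move=> e1 e2 le; rewrite /eqm /= e1 eqxx e2 perm_mset_diff. Qed.

Lemma reducible_head G y : reducible (G, y) ->
  head (0, mono1) (reducers G (appL G y)) \in reducers G (appL G y).
Proof. by rewrite /reducible /=; case: (reducers _ _) => // n l _; rewrite mem_head. Qed.

Lemma rcoef_neq0_lt f g m : supp f != [::] -> supp g != [::] -> eqm m (lm f) ->
  (forall m', rcoef f m' != 0 -> eqm m' m || ltm m' m) ->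
  (forall m', rcoef g m' != 0 -> rcoef f m' != 0 \/ (eqm m' m || ltm m' m)) ->
  rcoef g m = 0 -> ltm (lm g) (lm f).
Proof.
move=> nzf nzg e fm gm z; rewrite -(eqm_ltmr _ e).
have [/mem_supp[nz _] _] := lmP nzg.
have: eqm (lm g) m || ltm (lm g) m by case: (gm _ nz) => // /fm.
by case/orP => // /eqm_rcoef e'; rewrite e' z eqxx in nz.
Qed.

(** The scalar in [reducer] makes the two leading coefficients cancel, and everything else the
    reducer adds lies below. *)
Lemma reduce_step_lt G y : reducible (G, y) ->
  let y' := (reduce_step (G, y)).2 in
  supp (appL G y') != [::] -> ltm (lm (appL G y')) (lm (appL G y)).
Proof.
move=> /reducible_head; rewrite /reduce_step /=.
move: (head _ _) => [k m] /reducersP[/= nzf nz gm e ek] nzf'.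
have [al aub] := app_lam k gm nz.
have ub m' : rcoef (app G (k, m)) m' != 0 -> eqm m' (lm (appL G y)) || ltm m' (lm (appL G y)).
  by move=> /aub; rewrite (eqmr _ e) (eqm_ltmr _ e).
have [_ fub] := lmP nzf.
apply: (@rcoef_neq0_lt _ _ (lm (appL G y))) => //; first exact: eqm_refl.
  move=> m'; rewrite rcoef_appL_cons; case: (eqVneq (rcoef (appL G y) m') 0); last by left.
  by move=> ->; rewrite addr0 => /ub; right.
rewrite rcoef_appL_cons -(eqm_rcoef _ e) al ek mulNr divfK ?lc_neq0 //.
by rewrite -/(lc (appL G y)) addNr.
Qed.

Lemma reduce_terminates st : exists k, ~~ reducible (iter k reduce_step st).
Proof.
case: st => G y; have [m em] : exists m, m = lm (appL G y) by exists (lm (appL G y)).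
elim: (ltm_wf m) y em => {}m _ IH y em.
case: (boolP (reducible (G, y))) => [red|]; last by exists 0%N.
set y' := (reduce_step (G, y)).2.
(* A remainder without support offers no leading monomial to descend on; it has no reducer, so the
   loop stops after this step. *)
have [/eqP z|nz] := boolP (supp (appL G y') == [::]).
  have red0 : reducers G (appL G y') = [::] by rewrite /reducers z.
  by exists 1%N; rewrite -[iter _ _ _]/(G, y') /reducible red0.
have [|n nP] := IH (lm (appL G y')) _ y' erefl; first by rewrite em reduce_step_lt.
by exists n.+1; rewrite iterSr.
Qed.

Definition reduce_loop st :=
  iter (ex_minn (reduce_terminates st)) reduce_step st.

Definition reduce G y : seq term := (reduce_loop (G, y)).2.

(** The loop stops at the first irreducible state, so an invariant may use that every step taken
    starts from a reducible one. *)
Lemma reduce_ind G y (P : seq term -> Prop) : P y ->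
  (forall y, P y -> reducible (G, y) -> P (reduce_step (G, y)).2) -> P (reduce G y).
Proof.
move=> Py Pstep; rewrite /reduce /reduce_loop.
case: ex_minnP => n _ mn; suff: forall k, (k <= n)%N ->
    (iter k reduce_step (G, y)).1 = G /\ P (iter k reduce_step (G, y)).2.
  by move=> /(_ n (leqnn n))[].
elim=> [|k IH] kn //=; have [e Pk] := IH (ltnW kn).
have: reducible (iter k reduce_step (G, y)).
  by apply: contraTT kn => /mn; rewrite -leqNgt.
case: (iter k reduce_step (G, y)) e Pk => G' y' /= -> Pk red.
by split=> //; apply: Pstep.
Qed.

Lemma reduce_irr G y : reducers G (appL G (reduce G y)) = [::].
Proof.
have: ~~ reducible (reduce_loop (G, y)).
  by rewrite /reduce_loop; case: ex_minnP.
rewrite /reducible negbK /reduce => /nilP.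
suff -> : (reduce_loop (G, y)).1 = G by [].
rewrite /reduce_loop; elim: (ex_minn _) => //.
Qed.

(** * Completion and its termination *)

Definition remainders G : seq (seq term) :=
  [seq f <- [seq appL G (reduce G y) | y <- spairs G] | ~~ nilp (supp f)].

Definition incomplete G : bool := ~~ nilp (remainders G).

Definition add_remainder G : seq (seq term) := rcons G (head [::] (remainders G)).

(** Reduction creates no new summands and no longer lists of marks. Along the completion both data
    stay bounded, hence become constant on a subsequence, and only the columns are left to Higman's
    lemma. *)
Definition shape_le (D : nat) G : Prop :=
  forall g t, g \in G -> t \in g -> (t.2.2.1 <= D)%N /\ (size t.2.2.2 <= D)%N.

Lemma shape_le_ex G : exists D, shape_le D G.
Proof.
pose s := flatten [seq flatten [seq [:: t.2.2.1; size t.2.2.2] | t <- g] | g <- G].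
exists (foldr maxn 0%N s) => g t gG tg.
suff h x : x \in [:: t.2.2.1; size t.2.2.2] -> (x <= foldr maxn 0 s)%N.
  by split; apply: h; rewrite !inE eqxx ?orbT.
move=> xt; apply: leq_foldr_maxn; apply/flatten_mapP; exists g => //.
by apply/flatten_mapP; exists t.
Qed.

Lemma shape_le_appL D G y t : shape_le D G -> t \in appL G y ->
  (t.2.2.1 <= D)%N /\ (size t.2.2.2 <= D)%N.
Proof.
move=> sG /flatten_mapP[n _ /mapP[u uG ->]] /=; rewrite size_map.
have [iG|iG] := ltnP n.2.2.1 (size G); first exact: sG (mem_nth [::] iG) uG.
by rewrite nth_default in uG.
Qed.

Lemma mem_remainders G : incomplete G -> let r := head [::] (remainders G) in
  supp r != [::] /\ exists2 y, y \in spairs G & r = appL G (reduce G y).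
Proof.
rewrite /incomplete /= => nz; have: head [::] (remainders G) \in remainders G.
  by case: (remainders G) nz => // r l _; rewrite mem_head.
by rewrite mem_filter => /andP[/nilP/eqP ? /mapP[y ? ?]]; split=> //; exists y.
Qed.

Lemma add_remainder_shape D G : incomplete G -> shape_le D G -> shape_le D (add_remainder G).
Proof.
move=> inc sG g t; rewrite mem_rcons inE => /orP[/eqP->|]; last exact: sG.
by have [_ [y _ ->]] := mem_remainders inc; apply: shape_le_appL.
Qed.

(* A column of a monomial: its number of marks and the exponents of its variables. *)
Definition letter m (j : nat) : nat * ('I_c -> nat) :=
  (count_mem j m.2.2, fun r => count_mem (r, j) m.1).

Definition letter_le (x y : nat * ('I_c -> nat)) : Prop :=
  (x.1 <= y.1)%N /\ forall r, (x.2 r <= y.2 r)%N.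

(** Dickson's lemma for the number of marks and the [c] exponents of a column. *)
Lemma letter_le_subseq (f : nat -> nat * ('I_c -> nat)) : exists g : nat -> nat,
  (forall i, g i < g i.+1)%N /\
  (forall a b, (a < b)%N -> letter_le (f (g a)) (f (g b))).
Proof.
have [g [gS gm]] := nondecreasing_subseq
  ((fun i => (f i).1) :: map (fun r i => (f i).2 r) (enum 'I_c)).
exists g; split=> // a b ab; split; first exact: (gm (fun i => (f i).1) (or_introl erefl)).
move=> r; apply: (gm (fun i => (f i).2 r)) => //; right.
have: r \in enum 'I_c by rewrite mem_enum.
elim: (enum 'I_c) => //= x s IH; rewrite inE => /orP[/eqP->|/IH]; first by left.
by right.
Qed.

(** The positions of the embedding are the values of p: each column of the smaller leading monomial
    is dominated by its image. Variables only have to divide, but marks must coincide; domination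
    with equally many marks forces this by [sub_count_perm]. *)
Lemma emb_reducer G i f : (i < size G)%N -> supp (nth [::] G i) != [::] -> supp f != [::] ->
  (lm (nth [::] G i)).2.1 = (lm f).2.1 ->
  size (lm (nth [::] G i)).2.2 = size (lm f).2.2 ->
  emb letter_le (mkseq (letter (lm (nth [::] G i))) (width (nth [::] G i)))
                (mkseq (letter (lm f)) (width f)) ->
  reducers G f != [::].
Proof.
move=> iG nzg nzf ei es /emb_positions[p []]; rewrite !size_mkseq => sp szp pw pR.
have pin : p \in incs (width (nth [::] G i)) (width f) by rewrite mem_incs sp szp eqxx.
have [mg _] := lmP nzg; have [_ [tg tgG mgE]] := mem_supp mg.
have gm b : gterm G (b, (i, p)) by rewrite /gterm /= iG sp szp eqxx.
have [t [_ _ /(_ nzg) lamE]] := gterm_Inc (gm [::]).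
have [t' tE] := Inc_extend sp.
have atE : act (nth 0%N p) (lm (nth [::] G i)) = act t' (lm (nth [::] G i)).
  apply: act_eq_in => j; rewrite mgE => /(cols_width tgG).
  by rewrite -szp => /tE->.
have le j : (j < width (nth [::] G i))%N ->
    letter_le (letter (lm (nth [::] G i)) j) (letter (lm f) (t' j)).
  move=> jw; have := pR (0%N, fun => 0%N) j jw; rewrite nth_mkseq // nth_mkseq ?tE ?szp //.
  by apply: (allP pw); rewrite mem_nth ?szp.
have lew j : j \in cols (lm (nth [::] G i)) ->
    letter_le (letter (lm (nth [::] G i)) j) (letter (lm f) (t' j)).
  by rewrite mgE => /(cols_width tgG)/le; rewrite mgE.
suff: reducer G f i p \in reducers G f by case: (reducers _ _).
rewrite /reducers; case: nilP nzf => [->//|_ _]; rewrite mem_filter; apply/andP; split.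
  apply/andP; split; first by apply/nilP/eqP.
  have -> : lam G (reducer G f i p).2 = mulm (mset_diff (lm f).1 (act t' (lm (nth [::] G i))).1)
      (act t' (lm (nth [::] G i))) by rewrite -atE.
  apply: eqm_mulm_diff; first exact: ei.
    apply: sub_count_perm; last by rewrite size_map es.
    move=> x; have [/mapP[j jm ->]|/count_memPn->//] :=
      boolP (x \in map t' (lm (nth [::] G i)).2.2).
    rewrite count_mem_map_inj; last exact: Inc_inj.
    by case: (lew j) => //; rewrite mem_cat jm orbT.
  move=> x; have [/mapP[v vm ->]|/count_memPn->//] :=
    boolP (x \in [seq (v.1, t' v.2) | v <- (lm (nth [::] G i)).1]).
  rewrite (count_mem_map_inj _ _ (@act_var_inj c t')).
  case: v vm => r j vm; case: (lew j) => //; first by rewrite mem_cat (map_f snd vm).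
  by move=> _ /(_ r).
apply/flatten_mapP; exists i; first by rewrite mem_iota.
by apply/mapP; exists p.
Qed.

(** In an infinite run each remainder is irreducible modulo the earlier ones, while Higman's lemma
    embeds an earlier leading monomial into a later one. The words run over the full [width], past
    the last column of the leading monomial if need be, because a reducer must place all columns of
    the earlier remainder. *)
Lemma completion_terminates G : exists k, ~~ incomplete (iter k add_remainder G).
Proof.
apply: NNPP => no; pose H k := iter k add_remainder G.
have inc k : incomplete (H k).
  by apply: NNPP => /negP nk; apply: no; exists k.
pose r k := head [::] (remainders (H k)).
have rnz k : supp (r k) != [::] by have [] := mem_remainders (inc k).
have rirr k : reducers (H k) (r k) = [::].
  by have [_ [y _ e]] := mem_remainders (inc k); rewrite /r e reduce_irr.
have HS k : H k.+1 = rcons (H k) (r k) by [].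
have szH k : size (H k) = (size G + k)%N.
  by elim: k => [|k IH]; rewrite ?addn0 // HS size_rcons IH addnS.
(* The remainder added at step j keeps index [size G + j] in all later sets. *)
have nthH k j : (j < k)%N -> nth [::] (H k) (size G + j) = r j.
  elim: k => // k IH; rewrite ltnS leq_eqVlt HS nth_rcons szH => /orP[/eqP->|jk].
    by rewrite ltnn eqxx.
  by rewrite ltn_add2l jk IH.
have [D sG] := shape_le_ex G.
have sH k : shape_le D (H k) by elim: k => // k; apply: add_remainder_shape.
have sr k : ((lm (r k)).2.1 <= D)%N /\ (size (lm (r k)).2.2 <= D)%N.
  have [ms _] := lmP (rnz k); have [_ [t tr ->]] := mem_supp ms.
  by apply: (sH k.+1 (r k)); rewrite // HS mem_rcons mem_head.
(* A quantity bounded by D is constant along a subsequence on which neither it nor its complement to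
   D decreases. *)
have [g [gS gm]] := nondecreasing_subseq
  [:: (fun k => (lm (r k)).2.1); (fun k => D - (lm (r k)).2.1)%N;
      (fun k => size (lm (r k)).2.2); (fun k => D - size (lm (r k)).2.2)%N].
have gc a b : (a < b)%N -> (lm (r (g a))).2.1 = (lm (r (g b))).2.1 /\
    size (lm (r (g a))).2.2 = size (lm (r (g b))).2.2.
  move=> ab; have [s1 s2] := sr (g a); have [s3 s4] := sr (g b).
  have := gm _ (or_introl erefl) a b ab.
  have := gm _ (or_intror (or_introl erefl)) a b ab.
  have := gm _ (or_intror (or_intror (or_introl erefl))) a b ab.
  have := gm _ (or_intror (or_intror (or_intror (or_introl erefl)))) a b ab.
  by lia.
have [a [b [ab e]]] := higman letter_le_subseq
  (fun k => mkseq (letter (lm (r (g k)))) (width (r (g k)))).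
have gab : (g a < g b)%N by rewrite incr_seqP.
have := rirr (g b); apply/eqP; apply: (@emb_reducer _ (size G + g a)%N); rewrite ?nthH //.
- by rewrite szH ltn_add2l.
- by case: (gc a b ab).
- by case: (gc a b ab).
Qed.

Definition completion G : seq (seq term) :=
  iter (ex_minn (completion_terminates G)) add_remainder G.

Lemma completion_ind G (P : seq (seq term) -> Prop) : P G ->
  (forall G, P G -> incomplete G -> P (add_remainder G)) -> P (completion G).
Proof.
move=> PG Pstep; rewrite /completion; case: ex_minnP => k _ mn.
suff: forall j, (j <= k)%N -> P (iter j add_remainder G) by apply.
elim=> [|j IH] jk //=; apply: Pstep; first by apply: IH; apply: ltnW.
by apply: contraTT jk => /mn; rewrite -leqNgt.
Qed.

Lemma completion_complete G y : y \in spairs (completion G) ->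
  supp (appL (completion G) (reduce (completion G) y)) = [::].
Proof.
move=> ys; have: ~~ incomplete (completion G).
  by rewrite /completion; case: ex_minnP.
rewrite /incomplete negbK => /nilP e; apply/eqP; apply: contraT => /eqP/nilP nz.
suff: appL (completion G) (reduce (completion G) y) \in remainders (completion G) by rewrite e.
by rewrite mem_filter nz; apply: map_f.
Qed.

End Raw.

(** * Computable functions *)

(** The instances reproduce the encodings fixed for input and output, so no program has to convert
    between formats. *)
Class code (K : fieldType) (T : Type) := encode : T -> data K.

#[export] Instance code_nat K : code K nat := enc_nat K.
#[export] Instance code_unit (K : fieldType) : code K unit := fun _ => Defs.Nil.
#[export] Instance code_bool (K : fieldType) : code K bool := @dbool K.
#[export] Instance code_field (K : fieldType) : code K K := @Fld K.
#[export] Instance code_ord K n : code K 'I_n := @enc_ord K n.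
#[export] Instance code_prod K S T {eS : code K S} {eT : code K T} : code K (S * T) :=
  enc_pair eS eT.
#[export] Instance code_seq K T {eT : code K T} : code K (seq T) := enc_seq eT.
#[export] Instance code_mono K c : code K (mono c) := _ : code K (seq ('I_c * nat) * (nat * seq nat)).
#[export] Instance code_term K c : code K (term K c) := _ : code K (K * mono c).

Definition computable (K : fieldType) A B {eA : code K A} {eB : code K B} (f : A -> B) : Prop :=
  exists p, forall a, run p (eA a) (eB (f a)).

(* The first type argument G of a lemma is the type of the environment. *)
Section Combinators.
Context {K : fieldType}.
Local Notation code := (code K).

Lemma computable_eq A B {eA : code A} {eB : code B} (f g : A -> B) :
  f =1 g -> computable f -> computable g.
Proof. by move=> e [p pP]; exists p => a; rewrite -e. Qed.

Lemma run_Exec (o : instr) (x y : data K) : exec o x = y -> run (Exec o) x y.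
Proof. by move=> <-; constructor. Qed.

Lemma c_id G {eG : code G} : computable (fun g : G => g).
Proof. by exists (Exec IId) => g; apply: run_Exec. Qed.

Lemma c_comp G A B {eG : code G} {eA : code A} {eB : code B} (f : A -> B) (a : G -> A) :
  computable f -> computable a -> computable (fun g => f (a g)).
Proof.
by move=> [p pP] [q qP]; exists (Seq q p) => g; apply: run_seq (qP g) (pP _).
Qed.

Lemma c_pair G A B {eG : code G} {eA : code A} {eB : code B} (a : G -> A) (b : G -> B) :
  computable a -> computable b -> computable (fun g => (a g, b g)).
Proof.
by move=> [p pP] [q qP]; exists (Pair p q) => g; apply: run_pair (pP g) (qP g).
Qed.

Lemma c_fst G A B {eG : code G} {eA : code A} {eB : code B} (a : G -> A * B) :
  computable a -> computable (fun g => (a g).1).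
Proof. by apply: c_comp; exists (Exec IHead) => -[x y]; apply: run_Exec. Qed.

Lemma c_snd G A B {eG : code G} {eA : code A} {eB : code B} (a : G -> A * B) :
  computable a -> computable (fun g => (a g).2).
Proof. by apply: c_comp; exists (Exec ITail) => -[x y]; apply: run_Exec. Qed.

(** Makes the pair of arguments the environment, so that the body of [f] can be unfolded and treated
    along its syntax. *)
Lemma c_lift2 G A B C {eG : code G} {eA : code A} {eB : code B} {eC : code C}
    (f : A -> B -> C) (a : G -> A) (b : G -> B) :
  computable (fun u : A * B => f u.1 u.2) ->
  computable a -> computable b -> computable (fun g => f (a g) (b g)).
Proof. by move=> cf ca cb; apply: (c_comp cf (c_pair ca cb)). Qed.

Lemma c_if G A {eG : code G} {eA : code A} (b : G -> bool) (x y : G -> A) :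
  computable b -> computable x -> computable y ->
  computable (fun g => if b g then x g else y g).
Proof.
move=> [p pP] [q qP] [r rP]; exists (If p q r) => g; case E: (b g).
  by apply: run_if_true (pP g) _ (qP g); rewrite E.
by apply: run_if_false (rP g); have := pP g; rewrite E.
Qed.

Lemma c_nil G A {eG : code G} {eA : code A} : computable (fun _ : G => [::] : seq A).
Proof. by exists (Exec INil) => g; apply: run_Exec. Qed.

Lemma c_cons G A {eG : code G} {eA : code A} (x : G -> A) (s : G -> seq A) :
  computable x -> computable s -> computable (fun g => x g :: s g).
Proof.
by move=> [p pP] [q qP]; exists (Pair p q) => g; apply: run_pair (pP g) (qP g).
Qed.

Lemma c_behead G A {eG : code G} {eA : code A} (s : G -> seq A) :
  computable s -> computable (fun g => behead (s g)).
Proof. by apply: c_comp; exists (Exec ITail) => -[|x l]; apply: run_Exec. Qed.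

Lemma c_true G {eG : code G} : computable (fun _ : G => true).
Proof.
by exists (Pair (Exec INil) (Exec INil)) => g; apply: run_pair; apply: run_Exec.
Qed.

Lemma c_false G {eG : code G} : computable (fun _ : G => false).
Proof. by exists (Exec INil) => g; apply: run_Exec. Qed.

Lemma c_nilp G A {eG : code G} {eA : code A} (s : G -> seq A) :
  computable s -> computable (fun g => nilp (s g)).
Proof.
apply: c_comp; have [p pP] := @c_true (seq A) _.
exists (If (Exec IId) (Exec INil) p) => -[|x l].
  by apply: run_if_false (pP _); apply: run_Exec.
apply: (@run_if_true _ _ _ _ _ (encode (x :: l))) => //; exact: run_Exec.
Qed.

Lemma c_head G A {eG : code G} {eA : code A} (x : G -> A) (s : G -> seq A) :
  computable x -> computable s -> computable (fun g => head (x g) (s g)).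
Proof.
move=> [p pP] [q qP]; exists (If q (Seq q (Exec IHead)) p) => g.
have := qP g; case: (s g) => [|y l] qg; first by apply: run_if_false (pP g).
apply: run_if_true (qg) _ _ => //; apply: run_seq (qg) _; exact: run_Exec.
Qed.

(** The state of the loop holds the rest of the list, the accumulator and the environment. The list
    is its own guard, as its code is [Nil] only when it is empty. *)
Lemma c_foldl G A B {eG : code G} {eA : code A} {eB : code B}
    (f : G -> B -> A -> B) (z : G -> B) (s : G -> seq A) :
  computable (fun u : G * B * A => f u.1.1 u.1.2 u.2) ->
  computable z -> computable s ->
  computable (fun g => foldl (f g) (z g) (s g)).
Proof.
move=> [p pP] [q qP] [r rP].
pose H := Exec IHead; pose T := Exec ITail.
pose body := Pair (Seq H T)
  (Pair (Seq (Pair (Pair (Seq T T) (Seq T H)) (Seq H H)) p) (Seq T T)).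
exists (Seq (Pair r (Pair q (Exec IId))) (Seq (While H body) (Seq T H))) => g.
apply: run_seq (run_pair (rP g) (run_pair (qP g) (run_Exec (erefl _)))) _.
apply: (@run_seq _ _ _ _ (Defs.Cons Defs.Nil (Defs.Cons (eB (foldl (f g) (z g) (s g))) (eG g)))); last first.
  by apply: run_seq; apply: run_Exec.
elim: (s g) (z g) => [|a l IH] b.
  by apply: run_while_false; apply: run_Exec.
apply: run_while_true (IH (f g b a)); first exact: run_Exec.
  by [].
apply: run_pair; first by apply: run_seq; apply: run_Exec.
apply: run_pair; last by apply: run_seq; apply: run_Exec.
apply: run_seq (pP (g, b, a)); apply: run_pair; last by apply: run_seq; apply: run_Exec.
by apply: run_pair; apply: run_seq; apply: run_Exec.
Qed.

(** By minimality in [ex_minn] the test holds before every iteration performed and fails afterwards,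
    which is how [While] runs. Termination enters only as a proof; the number of iterations is not
    computed. *)
Lemma c_while S {eS : code S} (b : S -> bool) (f : S -> S)
    (halts : forall s, exists n, ~~ b (iter n f s)) :
  computable b -> computable f -> computable (fun s => iter (ex_minn (halts s)) f s).
Proof.
move=> [p pP] [q qP]; exists (While p q) => s.
case: ex_minnP => n; elim: n s => [|n IH] s nb mn.
  by apply: run_while_false; have := pP s; rewrite (negbTE nb).
have bs : b s by apply: contraT => /(mn 0%N).
apply: run_while_true (pP s) _ (qP s) _; first by rewrite bs.
rewrite iterSr; apply: IH => [|m]; first by rewrite -iterSr.
by rewrite -iterSr => /mn.
Qed.

Lemma c_rev G A {eG : code G} {eA : code A} (s : G -> seq A) :
  computable s -> computable (fun g => rev (s g)).
Proof.
apply: c_comp; apply: (@computable_eq _ _ _ _ (fun s => foldl (fun b a => a :: b) [::] s)).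
  move=> l; rewrite /rev; move: [::]; elim: l => //= a l IH z; exact: IH.
apply: (@c_foldl (seq A) A (seq A) _ _ _ (fun _ b a => a :: b) (fun _ => [::]) (fun s => s)).
- by apply: c_cons; [apply: c_snd|apply: c_snd; apply: c_fst]; apply: c_id.
- exact: c_nil.
- exact: c_id.
Qed.

Lemma c_foldr G A B {eG : code G} {eA : code A} {eB : code B}
    (f : G -> A -> B -> B) (z : G -> B) (s : G -> seq A) :
  computable (fun u : G * A * B => f u.1.1 u.1.2 u.2) ->
  computable z -> computable s ->
  computable (fun g => foldr (f g) (z g) (s g)).
Proof.
move=> cf cz cs.
apply: (@computable_eq _ _ _ _ (fun g => foldl (fun b a => f g a b) (z g) (rev (s g)))).
  by move=> g; rewrite foldl_rev.
apply: (@c_foldl G A B _ _ _ (fun g b a => f g a b)) => //; last exact: c_rev.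
apply: (c_comp cf (a := fun u : G * B * A => (u.1.1, u.2, u.1.2))).
apply: c_pair; first apply: c_pair.
- by do 2!apply: c_fst; apply: c_id.
- by apply: c_snd; apply: c_id.
- by apply: c_snd; apply: c_fst; apply: c_id.
Qed.

Lemma c_map G A B {eG : code G} {eA : code A} {eB : code B}
    (f : G -> A -> B) (s : G -> seq A) :
  computable (fun u : G * A => f u.1 u.2) -> computable s ->
  computable (fun g => map (f g) (s g)).
Proof.
move=> cf cs; apply: (@computable_eq _ _ _ _ (fun g => foldr (fun a l => f g a :: l) [::] (s g))) => //.
apply: c_foldr => //; last exact: c_nil.
apply: c_cons; last by apply: c_snd; apply: c_id.
by apply: (c_comp cf); apply: c_fst; apply: c_id.
Qed.

Lemma c_filter G A {eG : code G} {eA : code A} (f : G -> A -> bool) (s : G -> seq A) :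
  computable (fun u : G * A => f u.1 u.2) -> computable s ->
  computable (fun g => filter (f g) (s g)).
Proof.
move=> cf cs; apply: (@computable_eq _ _ _ _
  (fun g => foldr (fun a l => if f g a then a :: l else l) [::] (s g))) => //.
apply: c_foldr => //; last exact: c_nil.
apply: c_if; first by apply: (c_comp cf); apply: c_fst; apply: c_id.
  apply: c_cons; last by apply: c_snd; apply: c_id.
  by apply: c_snd; apply: c_fst; apply: c_id.
by apply: c_snd; apply: c_id.
Qed.

Lemma c_all G A {eG : code G} {eA : code A} (f : G -> A -> bool) (s : G -> seq A) :
  computable (fun u : G * A => f u.1 u.2) -> computable s ->
  computable (fun g => all (f g) (s g)).
Proof.
move=> cf cs; apply: (@computable_eq _ _ _ _
  (fun g => foldr (fun a b => if f g a then b else false) true (s g))) => //.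
apply: c_foldr => //; last exact: c_true.
apply: c_if; first by apply: (c_comp cf); apply: c_fst; apply: c_id.
  by apply: c_snd; apply: c_id.
exact: c_false.
Qed.

Lemma c_has G A {eG : code G} {eA : code A} (f : G -> A -> bool) (s : G -> seq A) :
  computable (fun u : G * A => f u.1 u.2) -> computable s ->
  computable (fun g => has (f g) (s g)).
Proof.
move=> cf cs; apply: (@computable_eq _ _ _ _
  (fun g => foldr (fun a b => if f g a then true else b) false (s g))) => //.
apply: c_foldr => //; last exact: c_false.
apply: c_if; first by apply: (c_comp cf); apply: c_fst; apply: c_id.
  exact: c_true.
by apply: c_snd; apply: c_id.
Qed.

Lemma c_cat G A {eG : code G} {eA : code A} (s t : G -> seq A) :
  computable s -> computable t -> computable (fun g => s g ++ t g).
Proof.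
move=> cs ct; apply: (@computable_eq _ _ _ _ (fun g => foldr cons (t g) (s g))) => [g|].
  by elim: (s g) => //= x l ->.
apply: (@c_foldr G A (seq A) _ _ _ (fun _ => cons)) => //.
by apply: c_cons; last apply: c_snd; [apply: c_snd; apply: c_fst|]; apply: c_id.
Qed.

Lemma c_rcons G A {eG : code G} {eA : code A} (s : G -> seq A) (x : G -> A) :
  computable s -> computable x -> computable (fun g => rcons (s g) (x g)).
Proof.
move=> cs cx; apply: (@computable_eq _ _ _ _ (fun g => s g ++ [:: x g])) => [g|].
  by rewrite cats1.
by apply: c_cat cs (c_cons cx _); apply: c_nil.
Qed.

Lemma c_flatten G A {eG : code G} {eA : code A} (s : G -> seq (seq A)) :
  computable s -> computable (fun g => flatten (s g)).
Proof.
move=> cs; apply: (@c_foldr G (seq A) (seq A) _ _ _ (fun _ => cat)) => //; last exact: c_nil.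
by apply: c_cat; apply: c_snd; [apply: c_fst|]; apply: c_id.
Qed.

Lemma c_nat G {eG : code G} (n : nat) : computable (fun _ : G => n).
Proof.
elim: n => [|n [p pP]]; first by exists (Exec INil) => g; apply: run_Exec.
by exists (Pair (Exec INil) p) => g; apply: run_pair (pP g); apply: run_Exec.
Qed.

Lemma c_S G {eG : code G} (n : G -> nat) : computable n -> computable (fun g => (n g).+1).
Proof.
by move=> [p pP]; exists (Pair (Exec INil) p) => g; apply: run_pair (pP g); apply: run_Exec.
Qed.

Lemma c_pred G {eG : code G} (n : G -> nat) : computable n -> computable (fun g => (n g).-1).
Proof. by apply: c_comp; exists (Exec ITail) => -[|k]; apply: run_Exec. Qed.

Lemma c_eq0 G {eG : code G} (n : G -> nat) : computable n -> computable (fun g => n g == 0%N).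
Proof.
apply: (@c_comp G nat bool _ _ _ (fun k => k == 0%N)); have [p pP] := @c_true nat _.
exists (If (Exec IId) (Exec INil) p) => -[|k].
  by apply: run_if_false (pP _); apply: run_Exec.
by apply: (@run_if_true _ _ _ _ _ (encode k.+1)) => //; apply: run_Exec.
Qed.

Lemma c_size G A {eG : code G} {eA : code A} (s : G -> seq A) :
  computable s -> computable (fun g => size (s g)).
Proof.
move=> cs; apply: (@computable_eq _ _ _ _ (fun g => foldr (fun _ n => n.+1) 0%N (s g))) => //.
apply: (@c_foldr G A nat _ _ _ (fun _ _ => S)) => //; last exact: c_nat.
by apply: c_S; apply: c_snd; apply: c_id.
Qed.

Lemma c_iter G A {eG : code G} {eA : code A} (n : G -> nat) (f : G -> A -> A) (x : G -> A) :
  computable (fun u : G * A => f u.1 u.2) -> computable n -> computable x ->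
  computable (fun g => iter (n g) (f g) (x g)).
Proof.
(* Naturals are coded in unary, so [n] has the same code as a list of [n] units, and iteration
   becomes a fold. *)
move=> cf cn cx; apply: (@computable_eq _ _ _ _ (fun g => foldr (fun _ => f g) (x g) (nseq (n g) tt))).
  by move=> g; elim: (n g) => //= k ->.
apply: (@c_foldr G unit A _ (code_unit K) _ (fun g _ => f g)) => //.
  apply: (c_comp cf (a := fun u : G * unit * A => (u.1.1, u.2))).
  by apply: c_pair; [do 2!apply: c_fst|apply: c_snd]; apply: c_id.
have [p pP] := cn; exists p => g; move: (pP g).
suff -> : code_nat K (n g) = enc_seq (code_unit K) (nseq (n g) tt) by [].
by elim: (n g) => //= k; rewrite /code_nat /enc_nat /= => ->.
Qed.

Lemma c_addn G {eG : code G} (m n : G -> nat) : computable m -> computable n ->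
  computable (fun g => (m g + n g)%N).
Proof.
move=> cm cn; apply: (@computable_eq _ _ _ _ (fun g => iter (m g) S (n g))).
  by move=> g; rewrite iter_succn addnC.
by apply: (@c_iter G nat _ _ m (fun _ => S)) => //; apply: c_S; apply: c_snd; apply: c_id.
Qed.

Lemma c_subn G {eG : code G} (m n : G -> nat) : computable m -> computable n ->
  computable (fun g => (m g - n g)%N).
Proof.
move=> cm cn; apply: (@computable_eq _ _ _ _ (fun g => iter (n g) predn (m g))).
  by move=> g; rewrite iter_predn.
by apply: (@c_iter G nat _ _ n (fun _ => predn)) => //; apply: c_pred; apply: c_snd; apply: c_id.
Qed.

Lemma c_muln G {eG : code G} (m n : G -> nat) : computable m -> computable n ->
  computable (fun g => (m g * n g)%N).
Proof.
move=> cm cn; apply: (@computable_eq _ _ _ _ (fun g => iter (m g) (addn (n g)) 0%N)).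
  by move=> g; rewrite iter_addn_0 mulnC.
apply: (@c_iter G nat _ _ m (fun g => addn (n g))) => //; last exact: c_nat.
by apply: c_addn; [apply: (c_comp cn); apply: c_fst|apply: c_snd]; apply: c_id.
Qed.

Lemma c_leq G {eG : code G} (m n : G -> nat) : computable m -> computable n ->
  computable (fun g => (m g <= n g)%N).
Proof. by move=> cm cn; apply: c_eq0; apply: c_subn. Qed.

Lemma c_andb G {eG : code G} (a b : G -> bool) : computable a -> computable b ->
  computable (fun g => a g && b g).
Proof.
move=> ca cb; apply: (@computable_eq _ _ _ _ (fun g => if a g then b g else false)) => //.
by apply: c_if => //; apply: c_false.
Qed.

Lemma c_orb G {eG : code G} (a b : G -> bool) : computable a -> computable b ->
  computable (fun g => a g || b g).
Proof.
move=> ca cb; apply: (@computable_eq _ _ _ _ (fun g => if a g then true else b g)) => //.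
by apply: c_if => //; apply: c_true.
Qed.

Lemma c_negb G {eG : code G} (a : G -> bool) : computable a -> computable (fun g => ~~ a g).
Proof.
move=> ca; apply: (@computable_eq _ _ _ _ (fun g => if a g then false else true)) => //.
by apply: c_if => //; [apply: c_false|apply: c_true].
Qed.

Lemma c_implyb G {eG : code G} (a b : G -> bool) : computable a -> computable b ->
  computable (fun g => a g ==> b g).
Proof.
move=> ca cb; apply: (@computable_eq _ _ _ _ (fun g => if a g then b g else true)) => //.
by apply: c_if => //; apply: c_true.
Qed.

Lemma c_eqn G {eG : code G} (m n : G -> nat) : computable m -> computable n ->
  computable (fun g => m g == n g).
Proof.
move=> cm cn; apply: (@computable_eq _ _ _ _ (fun g => (m g <= n g)%N && (n g <= m g)%N)).
  by move=> g; rewrite -eqn_leq.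
by apply: c_andb; apply: c_leq.
Qed.

Lemma c_maxn G {eG : code G} (m n : G -> nat) : computable m -> computable n ->
  computable (fun g => maxn (m g) (n g)).
Proof. by move=> cm cn; apply: c_if => //; apply: c_leq => //; apply: c_S. Qed.

Lemma c_iota0 G {eG : code G} (n : G -> nat) : computable n -> computable (fun g => iota 0 (n g)).
Proof.
move=> cn; apply: (@computable_eq _ _ _ _ (fun g => iter (n g) (fun s => rcons s (size s)) [::])).
  move=> g; elim: (n g) => // k IH.
  by rewrite iterS IH size_iota -addn1 iotaD /= cats1.
apply: (@c_iter G (seq nat) _ _ n (fun _ s => rcons s (size s))) => //; last exact: c_nil.
by apply: c_rcons; [|apply: c_size]; apply: c_snd; apply: c_id.
Qed.

Lemma c_nth G A {eG : code G} {eA : code A} (x : G -> A) (s : G -> seq A) (n : G -> nat) :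
  computable x -> computable s -> computable n ->
  computable (fun g => nth (x g) (s g) (n g)).
Proof.
move=> cx cs cn; apply: (@computable_eq _ _ _ _ (fun g => head (x g) (iter (n g) behead (s g)))).
  have nb k : iter k behead [::] = [::] :> seq A by elim: k => //= k ->.
  move=> g; elim: (n g) (s g) => [|k IH] [|y l]; rewrite ?nb ?nth_nil //.
  by rewrite iterSr; apply: IH.
apply: c_head => //; apply: (@c_iter G (seq A) _ _ n (fun _ => behead)) => //.
by apply: c_behead; apply: c_snd; apply: c_id.
Qed.

Lemma c_nseq G A {eG : code G} {eA : code A} (n : G -> nat) (x : G -> A) :
  computable n -> computable x -> computable (fun g => nseq (n g) (x g)).
Proof.
move=> cn cx; apply: (@computable_eq _ _ _ _ (fun g => iter (n g) (cons (x g)) [::])) => //.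
apply: (@c_iter G (seq A) _ _ n (fun g => cons (x g))) => //; last exact: c_nil.
by apply: c_cons; [apply: (c_comp cx); apply: c_fst|apply: c_snd]; apply: c_id.
Qed.

Lemma c_nat_of_ord G {eG : code G} n (i : G -> 'I_n) :
  computable i -> computable (fun g => nat_of_ord (i g)).
Proof. by move=> [p pP]; exists p. Qed.

Lemma c_eq_ord G {eG : code G} n (i j : G -> 'I_n) : computable i -> computable j ->
  computable (fun g => i g == j g).
Proof.
move=> ci cj; apply: (@computable_eq _ _ _ _ (fun g => nat_of_ord (i g) == nat_of_ord (j g))) => //.
by apply: c_eqn; apply: c_nat_of_ord.
Qed.

Lemma c_eq_var G {eG : code G} n (v w : G -> 'I_n * nat) : computable v -> computable w ->
  computable (fun g => v g == w g).
Proof.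
move=> cv cw; apply: (@computable_eq _ _ _ _
  (fun g => ((v g).1 == (w g).1) && ((v g).2 == (w g).2))) => [g|].
  by case: (v g) (w g) => [? ?] [? ?].
by apply: c_andb; [apply: c_eq_ord; apply: c_fst|apply: c_eqn; apply: c_snd].
Qed.

Lemma c_field0 G {eG : code G} : computable (fun _ : G => 0 : K).
Proof. by exists (Exec IZero) => g; apply: run_Exec. Qed.

Lemma c_addr G {eG : code G} (a b : G -> K) : computable a -> computable b ->
  computable (fun g => a g + b g).
Proof.
move=> [p pP] [q qP]; exists (Seq (Pair p q) (Exec Defs.IAdd)) => g.
by apply: run_seq (run_pair (pP g) (qP g)) _; apply: run_Exec.
Qed.

Lemma c_mulr G {eG : code G} (a b : G -> K) : computable a -> computable b ->
  computable (fun g => a g * b g).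
Proof.
move=> [p pP] [q qP]; exists (Seq (Pair p q) (Exec Defs.IMul)) => g.
by apply: run_seq (run_pair (pP g) (qP g)) _; apply: run_Exec.
Qed.

Lemma c_eqr G {eG : code G} (a b : G -> K) : computable a -> computable b ->
  computable (fun g => a g == b g).
Proof.
move=> [p pP] [q qP]; exists (Seq (Pair p q) (Exec IEq)) => g.
by apply: run_seq (run_pair (pP g) (qP g)) _; apply: run_Exec.
Qed.

Lemma c_oppr G {eG : code G} (a : G -> K) : computable a -> computable (fun g => - a g).
Proof. by apply: c_comp; exists (Exec Defs.IOpp) => x; apply: run_Exec. Qed.

Lemma c_invr G {eG : code G} (a : G -> K) : computable a -> computable (fun g => (a g)^-1).
Proof. by apply: c_comp; exists (Exec Defs.IInv) => x; apply: run_Exec. Qed.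

Section Multisets.
Context (T : eqType) {eT : code T}.
Hypothesis c_eq : forall G {eG : code G} (x y : G -> T), computable x -> computable y ->
  computable (fun g => x g == y g).

Lemma c_count_mem G {eG : code G} (x : G -> T) (s : G -> seq T) :
  computable x -> computable s -> computable (fun g => count_mem (x g) (s g)).
Proof.
move=> cx cs; apply: (@computable_eq _ _ _ _ (fun g => size [seq y <- s g | y == x g])) => [g|].
  by rewrite size_filter.
apply: c_size; apply: c_filter => //.
by apply: c_eq; [apply: c_snd|apply: (c_comp cx); apply: c_fst]; apply: c_id.
Qed.

Lemma c_perm_eq G {eG : code G} (s t : G -> seq T) :
  computable s -> computable t -> computable (fun g => perm_eq (s g) (t g)).
Proof.
move=> cs ct; apply: (@c_all G T _ _ (fun g x => count_mem x (s g) == count_mem x (t g))).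
  apply: c_eqn; apply: c_count_mem; try by apply: c_snd; apply: c_id.
    by apply: (c_comp cs); apply: c_fst; apply: c_id.
  by apply: (c_comp ct); apply: c_fst; apply: c_id.
exact: c_cat.
Qed.

Lemma c_mset_diff G {eG : code G} (s t : G -> seq T) :
  computable s -> computable t -> computable (fun g => mset_diff (s g) (t g)).
Proof.
move=> cs ct; have cu : computable (fun g => undup (s g)).
  apply: (@computable_eq _ _ _ _ (fun g =>
    foldr (fun x l => if has (fun y => y == x) l then l else x :: l) [::] (s g))) => [g|].
    elim: (s g) => //= x l ->; rewrite -mem_undup -has_pred1; congr (if _ then _ else _).
  apply: c_foldr => //; last exact: c_nil.
  apply: c_if; last by apply: c_cons; apply: c_snd; [apply: c_fst|]; apply: c_id.
    apply: c_has; last by apply: c_snd; apply: c_id.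
    by apply: c_eq; apply: c_snd; last (apply: c_fst; apply: c_fst); apply: c_id.
  by apply: c_snd; apply: c_id.
apply: c_flatten; apply: c_map => //; apply: c_nseq; last by apply: c_snd; apply: c_id.
apply: c_subn; apply: c_count_mem; try by apply: c_snd; apply: c_id.
  by apply: (c_comp cs); apply: c_fst; apply: c_id.
by apply: (c_comp ct); apply: c_fst; apply: c_id.
Qed.

End Multisets.
End Combinators.

(** Hook for the functions already shown computable; [comp] decomposes a body down to these and the
    basic combinators. *)
Ltac comp_lib := fail.

Ltac comp1 := cbn beta; first
  [ assumption
  | simple apply c_id | simple eapply c_pair | simple eapply c_fst | simple eapply c_snd
  | simple apply c_nil | simple eapply c_cons | simple eapply c_behead
  | simple apply c_true | simple apply c_false | simple eapply c_nilp | simple eapply c_head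
  | simple eapply c_map | simple eapply c_filter | simple eapply c_all | simple eapply c_has
  | simple eapply c_cat | simple eapply c_rcons | simple eapply c_flatten
  | simple apply c_nat | simple eapply c_S | simple eapply c_size | simple eapply c_foldr
  | simple eapply c_leq | simple eapply c_eqn | simple eapply c_maxn
  | simple eapply c_addn | simple eapply c_subn | simple eapply c_muln
  | simple eapply c_andb | simple eapply c_orb | simple eapply c_negb | simple eapply c_implyb
  | simple eapply c_if | simple eapply c_iota0 | simple eapply c_nth | simple eapply c_nseq
  | simple eapply c_iter
  | simple eapply c_nat_of_ord | simple eapply c_eq_ord | simple eapply c_eq_var
  | simple apply c_field0 | simple eapply c_addr | simple eapply c_mulr
  | simple eapply c_eqr | simple eapply c_oppr | simple eapply c_invr
  | comp_lib | apply c_id | eapply c_pair | apply c_field0 | eapply c_addr | eapply c_mulr | eapply c_eqr | eapply c_oppr | eapply c_invr ].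
Ltac comp := repeat comp1.

(** * Computability of the resolution procedure *)

Section Algorithm.
Context {K : fieldType} {c : nat}.
Local Notation code := (code K).
Local Notation V := ('I_c * nat)%type.
Local Notation mono := (mono c).
Local Notation term := (term K c).

Lemma c_count_mem_nat G {eG : code G} (x : G -> nat) (s : G -> seq nat) :
  computable x -> computable s -> computable (fun g => count_mem (x g) (s g)).
Proof. by apply: c_count_mem; apply: @c_eqn. Qed.

Ltac comp_lib ::= eapply c_count_mem_nat.

Lemma c_mset_lt G {eG : code G} (s t : G -> seq nat) : computable s -> computable t ->
  computable (fun g => mset_lt (s g) (t g)).
Proof. by apply: (c_lift2 (f := mset_lt)); rewrite /mset_lt; comp. Qed.

Lemma c_perm_eq_nat G {eG : code G} (s t : G -> seq nat) : computable s -> computable t ->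
  computable (fun g => perm_eq (s g) (t g)).
Proof. by apply: c_perm_eq; apply: @c_eqn. Qed.

Lemma c_perm_eq_var G {eG : code G} (s t : G -> seq V) : computable s -> computable t ->
  computable (fun g => perm_eq (s g) (t g)).
Proof. by apply: c_perm_eq; apply: (fun G' eG' => @c_eq_var K G' eG' c). Qed.

Lemma c_mset_diff_var G {eG : code G} (s t : G -> seq V) : computable s -> computable t ->
  computable (fun g => mset_diff (s g) (t g)).
Proof. by apply: c_mset_diff; apply: (fun G' eG' => @c_eq_var K G' eG' c). Qed.

Ltac comp_lib ::= first
  [ simple eapply c_perm_eq_nat | simple eapply c_perm_eq_var | simple eapply c_mset_diff_var
  | eapply c_perm_eq_nat | eapply c_perm_eq_var | eapply c_mset_diff_var
  | simple eapply c_mset_lt].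

Lemma c_eqm G {eG : code G} (m m' : G -> mono) : computable m -> computable m' ->
  computable (fun g => eqm (m g) (m' g)).
Proof. by apply: (c_lift2 (f := @eqm c)); rewrite /eqm; comp. Qed.

Lemma c_ltm G {eG : code G} (m m' : G -> mono) : computable m -> computable m' ->
  computable (fun g => ltm (m g) (m' g)).
Proof. by apply: (c_lift2 (f := @ltm c)); rewrite /ltm /vidx; comp. Qed.

Ltac comp_lib ::= first [ simple eapply c_eqm | simple eapply c_ltm ].

Lemma c_rcoef G {eG : code G} (f : G -> seq term) (m : G -> mono) :
  computable f -> computable m -> computable (fun g => rcoef (f g) (m g)).
Proof.
by apply: (c_lift2 (f := @rcoef K c)); rewrite /rcoef; comp.
Qed.

Ltac comp_lib ::= first
  [ simple eapply c_mset_diff_var | simple eapply c_eqm | simple eapply c_ltm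
  | simple eapply c_rcoef ].

Lemma c_supp G {eG : code G} (f : G -> seq term) :
  computable f -> computable (fun g => supp (f g)).
Proof. by apply: (c_comp (f := @supp K c)); rewrite /supp; comp. Qed.

Ltac comp_lib ::= first
  [ simple eapply c_mset_diff_var | simple eapply c_eqm | simple eapply c_ltm
  | simple eapply c_rcoef | simple eapply c_supp].

Lemma c_lm G {eG : code G} (f : G -> seq term) :
  computable f -> computable (fun g => lm (f g)).
Proof. by apply: (c_comp (f := @lm K c)); rewrite /lm /mono1; comp. Qed.

Ltac comp_lib ::= first
  [ simple eapply c_mset_diff_var | simple eapply c_eqm | simple eapply c_rcoef
  | simple eapply c_supp | simple eapply c_lm ].

Lemma c_width G {eG : code G} (f : G -> seq term) :
  computable f -> computable (fun g => width (f g)).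
Proof. by apply: (c_comp (f := @width K c)); rewrite /width /cols; comp. Qed.

Lemma c_incs G {eG : code G} (d w : G -> nat) : computable d -> computable w ->
  computable (fun g => incs (d g) (w g)).
Proof. by apply: (c_lift2 (f := incs)); rewrite /incs /subseqs; comp. Qed.

Lemma c_app G {eG : code G} (X : G -> seq (seq term)) (n : G -> term) :
  computable X -> computable n -> computable (fun g => app (X g) (n g)).
Proof. by apply: (c_lift2 (f := @app K c)); rewrite /app /mulm /act; comp. Qed.

Lemma c_lam G {eG : code G} (X : G -> seq (seq term)) (m : G -> mono) :
  computable X -> computable m -> computable (fun g => lam (X g) (m g)).
Proof. by apply: (c_lift2 (f := @lam K c)); rewrite /lam /mulm /act; comp. Qed.

Ltac comp_lib ::= first
  [ simple eapply c_mset_diff_var | simple eapply c_eqm | simple eapply c_rcoef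
  | simple eapply c_supp | simple eapply c_lm | simple eapply c_width
  | simple eapply c_incs | simple eapply c_app | simple eapply c_lam ].

Lemma c_appL G {eG : code G} (X : G -> seq (seq term)) (y : G -> seq term) :
  computable X -> computable y -> computable (fun g => appL (X g) (y g)).
Proof. by apply: (c_lift2 (f := @appL K c)); rewrite /appL; comp. Qed.

Lemma c_reducers G {eG : code G} (X : G -> seq (seq term)) (f : G -> seq term) :
  computable X -> computable f -> computable (fun g => reducers (X g) (f g)).
Proof.
by apply: (c_lift2 (f := @reducers K c)); rewrite /reducers /reducer /act /lc; comp.
Qed.

Ltac comp_lib ::= first
  [ simple eapply c_mset_diff_var | simple eapply c_eqm | simple eapply c_rcoef
  | simple eapply c_supp | simple eapply c_lm | simple eapply c_width
  | simple eapply c_incs | simple eapply c_app | simple eapply c_lam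
  | simple eapply c_appL | simple eapply c_reducers ].

Lemma c_reduce G {eG : code G} (X : G -> seq (seq term)) (y : G -> seq term) :
  computable X -> computable y -> computable (fun g => reduce (X g) (y g)).
Proof.
apply: (c_lift2 (f := @reduce K c)); rewrite /reduce; apply: c_snd.
apply: (c_comp (f := @reduce_loop K c)); last by comp.
apply: c_while; first by rewrite /reducible; comp.
by rewrite /reduce_step /mono1; comp.
Qed.

Lemma c_spairs G {eG : code G} (X : G -> seq (seq term)) :
  computable X -> computable (fun g => spairs (X g)).
Proof.
by apply: (c_comp (f := @spairs K c)); rewrite /spairs /spair /act /lc /mono1; comp.
Qed.

Ltac comp_lib ::= first
  [ simple eapply c_supp | simple eapply c_width | simple eapply c_appL
  | simple eapply c_reduce | simple eapply c_spairs ].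

Lemma c_remainders G {eG : code G} (X : G -> seq (seq term)) :
  computable X -> computable (fun g => remainders (X g)).
Proof. by apply: (c_comp (f := @remainders K c)); rewrite /remainders; comp. Qed.

Lemma c_completion G {eG : code G} (X : G -> seq (seq term)) :
  computable X -> computable (fun g => completion (X g)).
Proof.
apply: (c_comp (f := @completion K c)); apply: c_while.
  by rewrite /incomplete; comp; apply: c_remainders; comp.
by rewrite /add_remainder; comp; apply: c_remainders; comp.
Qed.

Definition terms_of_input (e : seq (seq (K * seq V) * (nat * seq nat))) : seq term :=
  flatten [seq [seq (u.1, (u.2, q.2)) | u <- q.1] | q <- e].

Definition output_of_terms (f : seq term) : seq (seq (K * seq V) * (nat * seq nat)) :=
  [seq ([:: (t.1, t.2.1)], t.2.2) | t <- f].

Definition generators (B : seq (seq term)) : seq (seq term) :=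
  completion [seq f <- B | ~~ nilp (supp f)].

(** [reduce] returns the steps together with the S-pair they started from, so the whole list maps to
    0. Its labels (i, p) refer to the new free module, and the result is again an argument for
    [generators] and [syzygies]. *)
Definition syzygies (B : seq (seq term)) : seq (seq term) :=
  [seq reduce (generators B) y | y <- spairs (generators B)].

Definition level (B : seq (seq term)) :=
  ([seq width g | g <- generators B], [seq output_of_terms g | g <- generators B]).

Definition resolution (u : nat * (seq nat * seq (seq (seq (K * seq V) * (nat * seq nat))))) :=
  [seq level (iter k syzygies [seq terms_of_input e | e <- u.2.2]) | k <- iota 0 u.1].

Lemma c_generators G {eG : code G} (B : G -> seq (seq term)) :
  computable B -> computable (fun g => generators (B g)).
Proof.
apply: (c_comp (f := generators)); rewrite /generators; apply: c_completion; comp.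
Qed.

Ltac comp_lib ::= first
  [ simple eapply c_supp | simple eapply c_width | simple eapply c_reduce
  | simple eapply c_spairs | simple eapply c_generators ].

Theorem c_resolution : computable resolution.
Proof. by rewrite /resolution /level /output_of_terms /syzygies /terms_of_input; comp. Qed.

End Algorithm.

(** * Lists of terms as elements of free modules *)

Section Interpretation.
Context (K : fieldType) (c : nat).
Local Notation V := ('I_c * nat)%type.
Local Notation mono := (mono c).
Local Notation term := (term K c).
Local Notation pol := (pol K c).

Definition xmon (vs : seq V) : pol := \prod_(v <- vs) pX K (v : var c).

Definition cmon (vs : seq V) : {cmonom var c} :=
  \big[mmul/mone]_(v <- vs) ucm (v : var c).

Lemma xmonE vs : xmon vs = << cmon vs >>.
Proof.
rewrite /xmon /cmon; elim: vs => [|v vs IH]; first by rewrite !big_nil pol1E.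
rewrite !big_cons IH /pX polMU mulr1; reflexivity.
Qed.

Lemma cmonE vs (v : var c) : cmon vs v = count_mem (v : V) vs.
Proof.
rewrite /cmon; elim: vs => [|w vs IH]; first by rewrite big_nil cm1.
by rewrite big_cons cmM cmU IH.
Qed.

Lemma cmon_perm vs ws : (cmon vs == cmon ws) = perm_eq vs ws.
Proof.
apply/eqP/idP => [e|/permP e]; last first.
  by apply/eqP/cmP => v; rewrite !cmonE e.
by apply/allP => v _ /=; rewrite -!cmonE e.
Qed.

Lemma cmon_surj (m : {cmonom var c}) : exists vs, cmon vs = m.
Proof.
exists (flatten [seq nseq (m v) (v : V) | v <- finsupp m]).
apply/eqP/cmP => v; rewrite cmonE count_flatten -map_comp sumnE big_map.
rewrite (eq_bigr (fun w => (w == v) * m w)%N); last by move=> w _; rewrite /= count_nseq.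
have [vm|vm] := boolP (v \in finsupp m).
  rewrite (big_fsetD1 v) //= eqxx mul1n big1_fset ?addn0 // => w.
  by rewrite in_fsetD1 => /andP[/negbTE->].
rewrite (fsfun_dflt vm) big1_fset // => w wm _.
by case: eqP wm => // ->; rewrite (negbTE vm).
Qed.

(* The monomial k * vs; locked, as unification would unfold the product of pol. *)
Definition pmono (k : K) (vs : seq V) : pol := locked (pC c k * xmon vs).

Lemma pmonoU k vs : pmono k vs = << k *g cmon vs >>.
Proof. by rewrite /pmono -lock xmonE /pC polMU mulr1 mul1m. Qed.

Lemma pmonoM k vs l ws : pmono k vs * pmono l ws = pmono (k * l) (vs ++ ws).
Proof.
rewrite (pmonoU k vs) (pmonoU l ws) (pmonoU (k * l)).
rewrite (polMU k l (cmon vs) (cmon ws)).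
have <- : mmul (cmon vs) (cmon ws) = cmon (vs ++ ws); last reflexivity.
by apply/eqP/cmP => v; rewrite cmM !cmonE count_cat.
Qed.

Lemma pmonoD k l vs : pmono (k + l) vs = pmono k vs + pmono l vs.
Proof. by rewrite !pmonoU; apply: monalgUD. Qed.

Lemma pmono0 vs : pmono 0 vs = 0.
Proof. by rewrite pmonoU; apply: monalgU0. Qed.

Lemma pol_act_xmon t vs : pol_act t (xmon vs) = xmon [seq (v.1, t v.2) | v <- vs].
Proof. by rewrite /xmon rmorph_prod big_map; apply: eq_bigr => v _; rewrite /= pol_actX. Qed.

Lemma pmonoE k vs : pmono k vs = pC c k * xmon vs.
Proof. by rewrite /pmono -lock. Qed.

Lemma pmono_act t k vs : pol_act t (pmono k vs) = pmono k [seq (v.1, t v.2) | v <- vs].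
Proof.
rewrite (pmonoE k vs) (pmonoE k (map _ _)) -(pol_act_xmon t vs) -[in RHS](pol_actC c t k).
exact: (rmorphM (pol_act t) (pC c k) (xmon vs)).
Qed.

Lemma mcoeff_pmono k vs m : (pmono k vs)@_m = k *+ (cmon vs == m).
Proof. by rewrite pmonoU; apply: mcoeffU. Qed.

(** * Labels and coordinates in a free module *)

Section FreeModule.
Context (L : choiceType) (d : L -> nat) (rank : L -> nat) (rank_inj : injective rank).
Local Notation basis := (fbasis d).
Local Notation F := (freeInc K c d).

Definition rawb (b : basis) : nat * seq nat := (rank (tag b), codom (val (tagged b))).

Lemma rawb_inj : injective rawb.
Proof.
move=> [i f] [i' f'] [/rank_inj e]; subst i' => /= ec; congr existT.
apply/val_inj/ffunP => k.
have := congr1 (fun s => nth 0%N s (enum_rank k)) ec.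
by rewrite !nth_codom enum_rankK.
Qed.

Lemma nth_codom_ord n (f : 'I_n -> nat) k (kn : (k < n)%N) :
  nth 0%N (codom f) k = f (Ordinal kn).
Proof.
rewrite codomE (nth_map (Ordinal kn)) ?size_enum_ord //.
by congr f; apply/val_inj; rewrite /= nth_enum_ord.
Qed.

Lemma sorted_rawb b : sorted ltn (rawb b).2.
Proof.
case: b => i f; apply/(sortedP 0%N) => k; rewrite size_codom card_ord => kd.
by rewrite (nth_codom_ord _ (ltnW kd)) (nth_codom_ord _ kd); apply: OI_mono.
Qed.

(** Classical choice enters only in the meaning of lists; the programs never test whether a label is
    valid. *)
Definition unbasis (q : nat * seq nat) : option basis :=
  if excluded_middle_informative (exists b, rawb b = q) is left h
  then Some (proj1_sig (constructive_indefinite_description _ h)) else None.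

Definition valid (q : nat * seq nat) : bool := unbasis q.

Lemma rawbK : pcancel rawb unbasis.
Proof.
move=> b; rewrite /unbasis; case: excluded_middle_informative => [h|[]]; last by exists b.
congr Some; apply: rawb_inj; exact: proj2_sig (constructive_indefinite_description _ h).
Qed.

Lemma unbasisP q b : unbasis q = Some b -> rawb b = q.
Proof.
rewrite /unbasis; case: excluded_middle_informative => // h [<-].
exact: proj2_sig (constructive_indefinite_description _ h).
Qed.

Lemma valid_rawb b : valid (rawb b).
Proof. by rewrite /valid rawbK. Qed.

Lemma rawb_surj q : valid q -> exists b, rawb b = q.
Proof. by rewrite /valid; case E : (unbasis q) => [b|] // _; exists b; apply: unbasisP. Qed.

Lemma valid_sorted q : valid q -> sorted ltn q.2.
Proof. by case/rawb_surj => b <-; apply: sorted_rawb. Qed.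

Definition termval (t : term) : F :=
  if unbasis t.2.2 is Some b then pmono t.1 t.2.1 *: << 1 *g b >> else 0.

Definition rval (f : seq term) : F := \sum_(t <- f) termval t.

Definition validl (f : seq term) : bool := all (fun t => valid t.2.2) f.

Lemma rval_nil : rval [::] = 0.
Proof. exact: big_nil. Qed.

Lemma rval_cons t f : rval (t :: f) = termval t + rval f.
Proof. exact: big_cons. Qed.

Lemma rval_cat f g : rval (f ++ g) = rval f + rval g.
Proof. exact: big_cat. Qed.

Lemma termvalE k vs b : termval (k, (vs, rawb b)) = << pmono k vs *g b >>.
Proof.
rewrite /termval /= rawbK; apply/malgP => b'.
by rewrite mcoeffZ !mcoeffU mulrnAr mulr1.
Qed.

Lemma termval_mulm k vs t : pmono k vs *: termval t = termval (k * t.1, mulm vs t.2).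
Proof.
rewrite /termval /=; case: (unbasis _) => [b|]; last exact: scaler0.
by rewrite -(pmonoM k vs t.1 t.2.1); apply: scalerA.
Qed.

Lemma rval_mulm k vs f : pmono k vs *: rval f =
  rval [seq (k * t.1, mulm vs t.2) | t <- f].
Proof.
by rewrite /rval big_map scaler_sumr; apply: eq_bigr => t _; rewrite termval_mulm.
Qed.

Lemma rawb_act (t : Inc) b : rawb (fbasis_act t b) = ((rawb b).1, map t (rawb b).2).
Proof.
case: b => i f; rewrite /rawb /=; congr (_, _); rewrite !codomE -map_comp.
by apply: eq_map => k; rewrite /= ffunE.
Qed.

Lemma valid_act (t : Inc) q : valid q -> valid (q.1, map t q.2).
Proof. by case/rawb_surj => b <-; rewrite -rawb_act valid_rawb. Qed.

Lemma termval_act (t : Inc) n : valid n.2.2 ->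
  inc_act t (termval n) = termval (n.1, act t n.2).
Proof.
case: n => k [vs q] /= /rawb_surj[b <-]; rewrite termvalE /act /= -rawb_act termvalE.
by rewrite free_actU pmono_act.
Qed.

Lemma inc_act0 (M : incModule K c) t : inc_act t (0 : M) = 0.
Proof.
by have := inc_actZ t (0 : pol) (0 : M); rewrite scaler0 rmorph0 scale0r.
Qed.

Lemma rval_act (t : Inc) f : validl f ->
  inc_act t (rval f) = rval [seq (n.1, act t n.2) | n <- f].
Proof.
elim: f => [|n f IH]; first by rewrite rval_nil inc_act0.
case/andP => vn vf; rewrite map_cons !rval_cons -(termval_act t vn) -(IH vf).
exact: inc_actD.
Qed.

(** Valid marks are strictly increasing, so permuted ones coincide; what remains is the order of the
    variables, which the commutative product ignores. *)
Lemma termval_perm k m m' : eqm m m' -> valid m.2 -> valid m'.2 -> termval (k, m) = termval (k, m').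
Proof.
case: m m' => vs [i p] [vs' [i' p']] /and3P[/= /eqP<- pp pv].
move=> /valid_sorted /= sp /valid_sorted /= sp'.
have -> : p' = p.
  by apply: (irr_sorted_eq ltn_trans ltnn) => // x; rewrite (perm_mem pp).
rewrite /termval /=; suff -> : pmono k vs = pmono k vs' by [].
have e : cmon vs = cmon vs' by apply/eqP; rewrite cmon_perm.
by rewrite (pmonoU k vs) (pmonoU k vs') e.
Qed.

Lemma termval0 m : termval (0, m) = 0.
Proof. by rewrite /termval pmono0; case: (unbasis _) => // b; apply: scale0r. Qed.

(* Since the order of the marks is irrelevant for eqm, they are sorted first. *)
Definition kcoef (m : mono) (x : F) : K :=
  if unbasis (m.2.1, sort leq m.2.2) is Some b then (mcoeff b x)@_(cmon m.1) else 0.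

Lemma kcoefD m x y : kcoef m (x + y) = kcoef m x + kcoef m y.
Proof. by rewrite /kcoef; case: (unbasis _) => [b|]; rewrite ?addr0 // mcoeffD mcoeffD. Qed.

Lemma kcoef0 m : kcoef m 0 = 0.
Proof. by rewrite /kcoef; case: (unbasis _) => // b; rewrite mcoeff0 mcoeff0. Qed.

Lemma kcoef_termval m t : valid t.2.2 -> kcoef m (termval t) = if eqm t.2 m then t.1 else 0.
Proof.
case: t => k [vs [i p]] /= vt; have /= sp := valid_sorted vt.
have [b be] := rawb_surj vt; rewrite -be termvalE /kcoef.
case E : (unbasis (m.2.1, _)) => [b'|].
  rewrite mcoeffU; case: eqVneq => [e|ne].
    rewrite mcoeff_pmono cmon_perm be; have := unbasisP E; rewrite -e be => -[ei ep].
    by rewrite /eqm /= ei eqxx ep perm_sort perm_refl /=; case: perm_eq.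
  rewrite mcoeff0 be /eqm /=; case: ifP => // /and3P[/eqP ei pp _]; case/eqP: ne.
  apply: rawb_inj; rewrite (unbasisP E) be ei; congr (_, _).
  apply: (irr_sorted_eq ltn_trans ltnn) => //; last by move=> x; rewrite mem_sort (perm_mem pp).
  rewrite ltn_sorted_uniq_leq sort_sorted ?andbT; last exact: leq_total.
  by rewrite sort_uniq -(perm_uniq pp) (sorted_uniq ltn_trans ltnn).
rewrite be; case: ifP => // /and3P[/= /eqP ei pp _].
have sE : sort leq m.2.2 = p.
  apply: (sorted_eq leq_trans anti_leq); first exact: sort_sorted leq_total _.
    by move: sp; rewrite ltn_sorted_uniq_leq => /andP[].
  by rewrite perm_sort perm_sym.
by move: E; rewrite sE -ei -be rawbK.
Qed.

(** The bridge from lists to elements: on valid lists the computed coefficient depends only on the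
    value. *)
Lemma kcoef_rval m f : validl f -> kcoef m (rval f) = rcoef f m.
Proof.
elim: f => [|t f IH]; first by rewrite rval_nil kcoef0.
case/andP => vt vf; rewrite rval_cons kcoefD IH // kcoef_termval //=.
by case: ifP; rewrite ?add0r.
Qed.

Lemma kcoef_eq0 x : (forall m, kcoef m x = 0) -> x = 0.
Proof.
move=> x0; apply/malgP => b; apply/malgP => m; rewrite !mcoeff0.
have [vs <-] := cmon_surj m; have := x0 (vs, rawb b).
have se : sort leq (rawb b).2 = (rawb b).2.
  apply: sorted_sort; first exact: leq_trans.
  by have := sorted_rawb b; rewrite ltn_sorted_uniq_leq => /andP[].
by rewrite /kcoef [X in unbasis X](_ : _ = rawb b) ?rawbK // [RHS]surjective_pairing -[in RHS]se.
Qed.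

Lemma rval_eq0 f : validl f -> supp f = [::] -> rval f = 0.
Proof. by move=> vf /supp_nil z; apply: kcoef_eq0 => m; rewrite kcoef_rval. Qed.

Lemma rval_surj (x : F) : exists2 f, validl f & rval f = x.
Proof.
pose good (x : F) := exists2 f, validl f & rval f = x.
have good0 : good 0 by exists [::] => //; rewrite /rval big_nil.
have goodD y z : good y -> good z -> good (y + z).
  move=> [f vf <-] [g vg <-]; exists (f ++ g); last exact: rval_cat.
  by rewrite /validl all_cat; apply/andP.
rewrite [x]monalgE; apply: (big_ind good) => // b _.
rewrite [x@_b]monalgE raddf_sum; apply: (big_ind good) => // m _.
have [vs <-] := cmon_surj m.
exists [:: (x@_b@_(cmon vs), (vs, rawb b))]; first by rewrite /= valid_rawb.
by rewrite /rval big_seq1 termvalE pmonoU.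
Qed.

End FreeModule.
End Interpretation.

(** * Morphisms out of free modules *)

Section FreeHom.
Context (K : fieldType) (c : nat) (L : choiceType) (d : L -> nat) (M : incModule K c).
Context (h : L -> M).
Hypothesis h_width : forall l (t t' : Inc), (forall j, (j < d l)%N -> t j = t' j) ->
  inc_act t (h l) = inc_act t' (h l).

Lemma OI_extend n (f : OI n) : exists t : Inc, forall k : 'I_n, t k = val f k.
Proof.
have su : sorted ltn (codom (val f)).
  apply/(sortedP 0%N) => k; rewrite size_codom card_ord => kn.
  by rewrite (nth_codom_ord _ (ltnW kn)) (nth_codom_ord _ kn); apply: OI_mono.
have [t tE] := Inc_extend su; exists t => k.
by rewrite tE ?size_codom ?card_ord // (nth_codom_ord _ (ltn_ord k)); congr (val f _); apply/val_inj.
Qed.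

Definition OI_ext n (f : OI n) : Inc :=
  proj1_sig (constructive_indefinite_description _ (OI_extend f)).

Lemma OI_extE n (f : OI n) (k : 'I_n) : OI_ext f k = val f k.
Proof. exact: (proj2_sig (constructive_indefinite_description _ (OI_extend f))). Qed.

(** The extension of the index map to [Inc] is a choice; [h_width] makes the result independent of
    it, which gives equivariance. *)
Definition basis_image (b : fbasis d) : M := inc_act (OI_ext (tagged b)) (h (tag b)).

Lemma basis_image_act t b : basis_image (fbasis_act t b) = inc_act t (basis_image b).
Proof.
rewrite /basis_image -inc_actM /=; apply: h_width => j jd.
by rewrite (OI_extE _ (Ordinal jd)) /= ffunE -(OI_extE _ (Ordinal jd)).
Qed.

Definition free_hom (x : freeInc K c d) : M :=
  \sum_(b <- msupp (x : free_car K c d)) (x : free_car K c d)@_b *: basis_image b.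

Lemma free_homEw (x : free_car K c d) (D : {fset fbasis d}) : (msupp x `<=` D)%fset ->
  free_hom x = \sum_(b <- D) x@_b *: basis_image b.
Proof.
move=> le; apply: (big_fset_incl _ le) => b _ bx.
by rewrite (mcoeff_outdom bx) scale0r.
Qed.

Lemma free_hom_linear : linear free_hom.
Proof.
move=> a x y; pose D := (msupp (x : free_car K c d) `|` msupp (y : free_car K c d))%fset.
rewrite (@free_homEw x D) ?fsubsetUl // (@free_homEw y D) ?fsubsetUr //.
rewrite (@free_homEw _ D); last first.
  apply: fsubset_trans (msuppD_le _ _) _; apply: fsetSU; exact: msuppZ_le.
rewrite scaler_sumr -big_split /=; apply: eq_bigr => b _.
by rewrite mcoeffD mcoeffZ scalerDl scalerA.
Qed.

HB.instance Definition _ :=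
  GRing.isLinear.Build (pol K c) (freeInc K c d) M _ free_hom free_hom_linear.

Lemma free_homU (a : pol K c) b : free_hom << a *g b >> = a *: basis_image b.
Proof. by rewrite (free_homEw msuppU_le) big_seq_fset1 mcoeffUU. Qed.

Lemma free_hom_act t x : free_hom (inc_act t x) = inc_act t (free_hom x).
Proof.
have actS (s : seq (fbasis d)) (F : fbasis d -> M) :
    inc_act t (\sum_(b <- s) F b) = \sum_(b <- s) inc_act t (F b).
  by elim: s => [|b s IH]; rewrite ?big_nil ?inc_act0 // !big_cons inc_actD IH.
rewrite {2}/free_hom actS -[inc_act t x]/(free_act t x) /free_act.
rewrite [LHS](linear_sum (GRing.Linear.clone _ _ _ _ free_hom _)); apply: eq_bigr => b _.
by rewrite inc_actZ -basis_image_act -free_homU.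
Qed.

Lemma free_hom_exists : exists phi : incHom (freeInc K c d) M, forall l, phi (fgen K c d l) = h l.
Proof.
exists (IncHom free_hom_act) => l; rewrite /= /fgen free_homU scale1r /basis_image /=.
rewrite -[RHS]inc_act1; apply: h_width => j jd.
by rewrite (OI_extE _ (Ordinal jd)) ffunE.
Qed.

End FreeHom.

(** * Lifting and reducing S-pairs *)

Lemma sorted_map_Inc (t : Inc) p : sorted ltn (map t p) = sorted ltn p.
Proof. by rewrite sorted_map; apply: eq_sorted => x y; rewrite /= Inc_lt. Qed.

(** The common map enumerates the union of the two ranges, and [p0] and [q0] record positions in
    that union. *)
Lemma factor_Inc (p q : seq nat) : sorted ltn p -> sorted ltn q ->
  exists (t : Inc) p0 q0, [/\ p = map t p0, q = map t q0,
    all (gtn (size p + size q)%N) p0 & all (gtn (size p + size q)%N) q0].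
Proof.
move=> sp sq; pose U := sort leq (undup (p ++ q)).
have sU : sorted ltn U.
  by rewrite ltn_sorted_uniq_leq sort_uniq undup_uniq sort_sorted //; apply: leq_total.
have szU : (size U <= size p + size q)%N by rewrite size_sort -size_cat size_undup.
have [t tE] := Inc_extend sU; exists t, (map (index^~ U) p), (map (index^~ U) q).
have tK s : {subset s <= U} -> map t (map (index^~ U) s) = s.
  move=> sub; rewrite -map_comp -[RHS]map_id; apply/eq_in_map => x xs /=.
  by rewrite tE ?nth_index ?index_mem ?sub.
have ub s : {subset s <= U} -> all (gtn (size p + size q)%N) (map (index^~ U) s).
  move=> sub; apply/allP => _ /mapP[x xs ->] /=.
  by apply: leq_trans szU; rewrite index_mem sub.
have pU : {subset p <= U} by move=> x xp; rewrite mem_sort mem_undup mem_cat xp.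
have qU : {subset q <= U} by move=> x xq; rewrite mem_sort mem_undup mem_cat xq orbT.
by split; rewrite ?tK ?ub.
Qed.

Lemma count_map_mset_diff (T U : eqType) (f : T -> U) (s t : seq T) x : injective f ->
  count_mem x (map f (mset_diff s t)) =
  (count_mem x (map f s) - count_mem x (map f t))%N.
Proof.
move=> fI; have [/mapP[v _ ->]|no] := boolP (x \in map f s).
  by rewrite !count_mem_map_inj // count_mset_diff.
rewrite (count_memPn no) sub0n; apply/count_memPn; apply: contra no.
case/mapP => v vd ->; apply: map_f; move: vd; rewrite -!has_pred1 !has_count count_mset_diff.
by lia.
Qed.

(** Exponents in an equality of products: x, z belong to the cofactors and y, w to the leading
    monomials. The lcm cofactor [w - y] divides x, and by the next lemma the same quotient completes
    [y - w] to z. *)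
Lemma addn_eq_subl (x y z w : nat) : (x + y = z + w -> x - (w - y) + (w - y) = x)%N.
Proof. by lia. Qed.

Lemma addn_eq_subr (x y z w : nat) : (x + y = z + w -> x - (w - y) + (y - w) = z)%N.
Proof. by lia. Qed.

Section LamAct.
Context (K : fieldType) (c : nat).
Implicit Types (m : mono c) (G : seq (seq (term K c))).

Lemma gterm_act G (t : Inc) e m : gterm G (mulm e (act t m)) = gterm G m.
Proof. by rewrite /gterm /= sorted_map_Inc size_map. Qed.

Lemma lam_act G (t : Inc) e m : gterm G m -> supp (nth [::] G m.2.1) != [::] ->
  lam G (mulm e (act t m)) = mulm e (act t (lam G m)).
Proof.
move=> /and3P[_ _ /eqP szp] nz.
have E : act (nth 0%N (map t m.2.2)) (lm (nth [::] G m.2.1)) =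
    act t (act (nth 0%N m.2.2) (lm (nth [::] G m.2.1))).
  rewrite -act_comp; apply: act_eq_in => j.
  have [/mem_supp[_ [u uG ->]] _] := lmP nz; move=> /(cols_width uG).
  by rewrite -szp => jp; rewrite (nth_map 0%N).
rewrite -[LHS]/(mulm (e ++ [seq (v.1, t v.2) | v <- m.1])
  (act (nth 0%N (map t m.2.2)) (lm (nth [::] G m.2.1)))) E act_mulm.
by rewrite /mulm /= catA.
Qed.

Lemma lam_eqm G m m' : gterm G m -> gterm G m' -> eqm m m' -> eqm (lam G m) (lam G m').
Proof.
case: m m' => [b [i p]] [b' [i' p']] /and3P[/= _ sp _] /and3P[/= _ sp' _].
move=> /and3P[/= /eqP <- pp pb]; have -> : p' = p.
  by apply: (irr_sorted_eq ltn_trans ltnn) => // x; rewrite (perm_mem pp).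
exact: eqm_mulml.
Qed.

Lemma supp_nth G i : (forall g, g \in G -> supp g != [::]) -> (i < size G)%N ->
  supp (nth [::] G i) != [::].
Proof. by move=> nzG iG; apply: nzG; apply: mem_nth. Qed.

Definition spair_of G (m m' : mono c) : seq (term K c) :=
  [:: ((lc (nth [::] G m.2.1))^-1, m); (- (lc (nth [::] G m'.2.1))^-1, m')].

Lemma spairsP G y : y \in spairs G -> exists m m',
  [/\ y = spair_of G m m', gterm G m, gterm G m' & eqm (lam G m) (lam G m')].
Proof.
rewrite mem_filter => /andP[e /flatten_mapP[i iG /flatten_mapP[j jG]]].
case/flatten_mapP => p pi /mapP[q qj ey]; move: e; rewrite ey => e.
move: iG jG pi qj; rewrite !mem_iota !mem_incs /= !add0n.
move=> iG jG /and3P[sp szp _] /and3P[sq szq _].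
set m := (nth (0, mono1 c) (spair G i j p q) 0).2 in e.
set m' := (nth (0, mono1 c) (spair G i j p q) 1).2 in e.
by exists m, m'; split=> //; apply/and3P.
Qed.

(** [factor_Inc] brings both maps below the bound used in [spairs], and dividing by the lcm turns
    the cofactors into those of [spair]. *)
Lemma lift_spair G m m' : (forall g, g \in G -> supp g != [::]) ->
  gterm G m -> gterm G m' -> eqm (lam G m) (lam G m') ->
  exists (t : Inc) e m0 m0', [/\ spair_of G m0 m0' \in spairs G,
    m0.2.1 = m.2.1 /\ m0'.2.1 = m'.2.1, gterm G m0 /\ gterm G m0',
    eqm m (mulm e (act t m0)) & eqm m' (mulm e (act t m0'))].
Proof.
case: m m' => [b [i p]] [b' [j q]] nzG gm gm' elam.
have /and3P[/= iG sp /eqP szp] := gm; have /and3P[/= jG sq /eqP szq] := gm'.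
have [t [p0 [q0 [pE qE p0w q0w]]]] := factor_Inc sp sq.
have sp0 : sorted ltn p0 by rewrite -(sorted_map_Inc t) -pE.
have sq0 : sorted ltn q0 by rewrite -(sorted_map_Inc t) -qE.
have szp0 : size p0 = width (nth [::] G i) by rewrite -szp pE size_map.
have szq0 : size q0 = width (nth [::] G j) by rewrite -szq qE size_map.
pose m1 := act (nth 0%N p0) (lm (nth [::] G i)).
pose m2 := act (nth 0%N q0) (lm (nth [::] G j)).
pose m0 := (mset_diff m2.1 m1.1, (i, p0)) : mono c.
pose m0' := (mset_diff m1.1 m2.1, (j, q0)) : mono c.
have gm0 : gterm G m0 by apply/and3P; split=> //; apply/eqP.
have gm0' : gterm G m0' by apply/and3P; split=> //; apply/eqP.
have lE : lam G (b, (i, p)) = mulm b (act t m1).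
  rewrite pE; have g0 : gterm G ([::], (i, p0)) by apply/and3P; split=> //; apply/eqP.
  rewrite -[LHS]/(mulm b (lam G (mulm [::] (act t ([::], (i, p0)))))).
  by rewrite (lam_act t [::] g0 (supp_nth nzG iG)).
have lE' : lam G (b', (j, q)) = mulm b' (act t m2).
  rewrite qE; have g0 : gterm G ([::], (j, q0)) by apply/and3P; split=> //; apply/eqP.
  rewrite -[LHS]/(mulm b' (lam G (mulm [::] (act t ([::], (j, q0)))))).
  by rewrite (lam_act t [::] g0 (supp_nth nzG jG)).
pose ft (v : 'I_c * nat) := (v.1, t v.2); have ftI : injective ft := @act_var_inj c t.
move: elam; rewrite lE lE' => elam; have /and3P[_ _ /permP ec] := elam.
have {}ec x : (count_mem x b + count_mem x (map ft m1.1) =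
               count_mem x b' + count_mem x (map ft m2.1))%N.
  by have := ec (pred1 x); rewrite /= !count_cat.
(* The quotient of the common leading monomial by the lcm of the two translated ones. *)
pose e := mset_diff b (map ft m0.1).
have eb : perm_eq b (e ++ map ft m0.1).
  apply/allP => x _ /=; apply/eqP.
  by rewrite count_cat count_mset_diff count_map_mset_diff // (addn_eq_subl (ec x)).
have eb' : perm_eq b' (e ++ map ft m0'.1).
  apply/allP => x _ /=; apply/eqP.
  by rewrite count_cat count_mset_diff !count_map_mset_diff // (addn_eq_subr (ec x)).
have e0 : eqm (b, (i, p)) (mulm e (act t m0)) by rewrite /eqm /= eqxx -pE perm_refl eb.
have e0' : eqm (b', (j, q)) (mulm e (act t m0')) by rewrite /eqm /= eqxx -qE perm_refl eb'.
exists t, e, m0, m0'; split=> //.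
have el0 : eqm (lam G m0) (lam G m0').
  rewrite -(eqm_act t) -(eqm_mulm e) -!(lam_act t e) //; try exact: supp_nth.
  have h1 := lam_eqm gm _ e0; have h2 := lam_eqm gm' _ e0'.
  by rewrite -(eqml _ (h1 _)) -?(eqmr _ (h2 _)) ?gterm_act // lE lE'.
rewrite mem_filter; apply/andP; split; first exact: el0.
apply/flatten_mapP; exists i; first by rewrite mem_iota.
apply/flatten_mapP; exists j; first by rewrite mem_iota.
apply/flatten_mapP; exists p0; first by rewrite mem_incs sp0 szp0 eqxx -szp -szq.
by apply/mapP; exists q0; first by rewrite mem_incs sq0 szq0 eqxx -szp -szq.
Qed.

Lemma reduce_gterm G y : all (fun n => gterm G n.2) y -> all (fun n => gterm G n.2) (reduce G y).
Proof.
move=> gy; apply: (reduce_ind (P := fun z => all (fun n => gterm G n.2) z)) => // y' gy' /reducible_head/reducersP[_ _ gn _ _].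
by apply/andP.
Qed.

Lemma app_lt G k m M : (forall g, g \in G -> supp g != [::]) -> gterm G m -> ltm (lam G m) M ->
  forall m', rcoef (app G (k, m)) m' != 0 -> ltm m' M.
Proof.
move=> nzG gm lt m' nz; have /and3P[iG _ _] := gm.
have [_ /(_ _ nz)/orP[e|lt']] := app_lam k gm (supp_nth nzG iG).
  by rewrite (eqm_ltml _ e).
exact: ltm_trans lt' lt.
Qed.

(** The leading terms of the pair cancel, so every remainder lies strictly below their common
    monomial, and a reducer has the leading monomial of the remainder it acts on. *)
Lemma reduce_spair G m m' : (forall g, g \in G -> supp g != [::]) ->
  gterm G m -> gterm G m' -> eqm (lam G m) (lam G m') ->
  exists y, [/\ reduce G (spair_of G m m') = y ++ spair_of G m m',
    all (fun n => gterm G n.2) y & all (fun n => ltm (lam G n.2) (lam G m)) y].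
Proof.
move=> nzG gm gm' e; set y0 := spair_of G m m'.
pose P z := (exists y, [/\ z = y ++ y0, all (fun n => gterm G n.2) y
  & all (fun n => ltm (lam G n.2) (lam G m)) y]) /\
  forall m1, rcoef (appL G z) m1 != 0 -> ltm m1 (lam G m).
suff [] : P (reduce G y0) by [].
apply: (reduce_ind (P := P)) => [|z [[y [-> gy lty]] ltz] red].
  split; first by exists [::].
  have /and3P[iG _ _] := gm; have /and3P[jG _ _] := gm'.
  have nzi := supp_nth nzG iG; have nzj := supp_nth nzG jG.
  move=> m1; rewrite /y0 /spair_of !rcoef_appL_cons /= addr0.
  have [a1 u1] := app_lam (lc (nth [::] G m.2.1))^-1 gm nzi.
  have [a2 u2] := app_lam (- (lc (nth [::] G m'.2.1))^-1) gm' nzj.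
  (* At the common leading monomial the inverse leading coefficients contribute 1 and -1. *)
  have [e1|ne1] := boolP (eqm m1 (lam G m)).
    rewrite (eqm_rcoef _ e1) a1 (eqm_rcoef _ (eqm_trans e1 e)) a2 mulNr !mulVf ?lc_neq0 //.
    by rewrite subrr eqxx.
  case: (eqVneq (rcoef (app G ((lc (nth [::] G m.2.1))^-1, m)) m1) 0) => [->|/u1]; last by rewrite (negbTE ne1).
  by rewrite add0r => /u2; rewrite -(eqmr _ e) -(eqm_ltmr _ e) (negbTE ne1).
have /reducersP[nzf _ gn en _] := reducible_head red.
rewrite /reduce_step /=; set n := head _ _ in gn en *.
have [lf _] := lmP nzf; have [nzlf _] := mem_supp lf.
have ltn : ltm (lam G n.2) (lam G m) by rewrite (eqm_ltml _ en); apply: ltz.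
split; first by exists (n :: y); split=> //=; apply/andP.
move=> m1; rewrite rcoef_appL_cons; case: (eqVneq (rcoef (appL G (y ++ y0)) m1) 0).
  move=> ->; rewrite addr0; move: ltn; rewrite {1}[n]surjective_pairing => ltn.
  by rewrite [n]surjective_pairing; apply: app_lt.
by move=> /ltz.
Qed.

End LamAct.

Section Span.
Context (K : fieldType) (c : nat) (M : incModule K c) (X : M -> Prop).

Lemma incSpan_submodule : incSubmodule (incSpan X).
Proof.
split=> [S|x y Sx Sy S|a x Sx S|t x Sx S] sS XS; have [S0 SD SZ SA] := sS.
- exact: S0.
- by apply: SD; [apply: Sx|apply: Sy].
- by apply: SZ; apply: Sx.
- by apply: SA; apply: Sx.
Qed.

Lemma incSpan_gen x : X x -> incSpan X x.
Proof. by move=> Xx S _; apply. Qed.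

Lemma incSpanB x y : incSpan X x -> incSpan X y -> incSpan X (x - y).
Proof.
have [_ SD SZ _] := incSpan_submodule => Sx Sy; apply: SD => //.
by rewrite -scaleN1r; apply: SZ.
Qed.

End Span.

Section FreeTerms.
Context (K : fieldType) (c : nat) (L : choiceType) (d : L -> nat).
Context (rank : L -> nat) (rank_inj : injective rank).
Local Notation F := (freeInc K c d).
Local Notation termval := (@termval K c L d rank).
Local Notation rval := (@rval K c L d rank).

Lemma rawb_build l (p : seq nat) : sorted ltn p -> size p = d l ->
  exists b : fbasis d, rawb rank b = (rank l, p).
Proof.
move=> sp szp; pose f : {ffun 'I_(d l) -> nat} := [ffun k : 'I_(d l) => nth 0%N p k].
have fP : [forall k : 'I_(d l), forall k' : 'I_(d l), (k < k')%N ==> (f k < f k')%N].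
  apply/forallP => k; apply/forallP => k'; apply/implyP => kk; rewrite !ffunE.
  by apply: (sorted_ltn_nth ltn_trans 0%N sp) => //; rewrite inE szp.
exists (Tagged (fun l => OI (d l)) (exist _ f fP : OI (d l))).
congr (_, _); apply: (@eq_from_nth _ 0%N); rewrite size_codom card_ord ?szp // => k kd.
by rewrite (nth_codom_ord _ kd) ffunE.
Qed.

Lemma valid_build l (p : seq nat) : sorted ltn p -> size p = d l -> valid d rank (rank l, p).
Proof. by move=> sp szp; have [b <-] := rawb_build sp szp; apply: valid_rawb. Qed.

Lemma fgen_termval l : fgen K c d l = termval (1, ([::], (rank l, iota 0 (d l)))).
Proof.
have <- : rawb rank (Tagged (fun l => OI (d l)) (OI_id (d l)) : fbasis d) = (rank l, iota 0 (d l)).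
  congr (_, _); rewrite codomE -val_enum_ord; apply: eq_map => k.
  by rewrite /= ffunE.
rewrite (termvalE rank_inj) (pmonoU 1 [::]).
suff -> : cmon ([::] : seq ('I_c * nat)) = mone by rewrite pol1E.
by rewrite /cmon big_nil.
Qed.

Lemma termval_fgen_act k vs l (t : Inc) :
  termval (k, (vs, (rank l, [seq t j | j <- iota 0 (d l)]))) = pmono k vs *: inc_act t (fgen K c d l).
Proof.
rewrite fgen_termval (termval_act rank_inj t) /=; last first.
  by apply: valid_build; rewrite ?iota_ltn_sorted ?size_iota.
by rewrite termval_mulm mulr1 /mulm /= cats0.
Qed.

Lemma scale_rval a f : pmono a [::] *: rval f = rval [seq (a * n.1, n.2) | n <- f].
Proof. by rewrite rval_mulm; congr rval; apply: eq_map => -[k [vs q]]. Qed.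

End FreeTerms.

(** * The completed generating set *)

Section Generators.
Context (K : fieldType) (c : nat) (L : choiceType) (d : L -> nat).
Context (rank : L -> nat) (rank_inj : injective rank).
Local Notation term := (term K c).
Local Notation termval := (@termval K c L d rank).
Local Notation rval := (@rval K c L d rank).
Local Notation validl := (@validl K c L d rank).
Implicit Types (G : seq (seq term)) (n : term).

Lemma validl_nth G i : all validl G -> validl (nth [::] G i).
Proof.
move=> /allP vG; have [iG|iG] := ltnP i (size G); first by apply: vG; apply: mem_nth.
by rewrite nth_default.
Qed.

Lemma rval_app G n : all validl G -> gterm G n.2 -> exists t : Inc,
  n.2.2.2 = [seq t j | j <- iota 0 (width (nth [::] G n.2.2.1))] /\
  rval (app G n) = pmono n.1 n.2.1 *: inc_act t (rval (nth [::] G n.2.2.1)).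
Proof.
case: n => k m vG gm; have [t [pE aE _]] := gterm_Inc gm; exists t; split=> //.
rewrite (rval_act rank_inj t (validl_nth _ vG)) rval_mulm aE -map_comp.
by [].
Qed.

Lemma validl_app G n : all validl G -> gterm G n.2 -> validl (app G n).
Proof.
case: n => k m vG gm; have [t [_ aE _]] := gterm_Inc gm; rewrite aE /validl all_map.
apply: sub_all (validl_nth m.2.1 vG) => u vu; exact: (valid_act rank_inj t vu).
Qed.

Lemma validl_appL G y : all validl G -> all (fun n => gterm G n.2) y -> validl (appL G y).
Proof.
move=> vG; elim: y => //= n y IH /andP[gn gy].
by rewrite /validl all_cat; apply/andP; split; [apply: validl_app|apply: IH].
Qed.

Lemma rval_appL_cons G n y : rval (appL G (n :: y)) = rval (app G n) + rval (appL G y).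
Proof. exact: rval_cat. Qed.

Lemma rval_appL_span (X : freeInc K c d -> Prop) G y : all validl G ->
  (forall g, g \in G -> incSpan X (rval g)) -> all (fun n => gterm G n.2) y ->
  incSpan X (rval (appL G y)).
Proof.
move=> vG XG; have [S0 SD SZ SA] := incSpan_submodule X.
elim: y => [|n y IH] /=; first by rewrite rval_nil.
case/andP => gn gy; rewrite rval_appL_cons; apply: (SD _ _ _ (IH gy)).
have [t [_ ->]] := rval_app vG gn; apply: (SZ _ _); apply: SA; apply: XG.
by case/and3P: gn => iG _ _; apply: mem_nth.
Qed.

Lemma spair_gterm G y : y \in spairs G -> all (fun n => gterm G n.2) y.
Proof. by case/spairsP => m [m' [-> gm gm' _]]; rewrite /= gm gm'. Qed.

(** A remainder is a combination of translates of elements already present, so adding it preserves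
    validity and the span; elements of [B] that are dropped have value 0. *)
Lemma generatorsP (B : seq (seq term)) : all validl B ->
  let X := fun x => exists2 b, b \in B & x = rval b in
  let G := generators B in
  [/\ all validl G, forall g, g \in G -> supp g != [::],
      forall g, g \in G -> incSpan X (rval g),
      forall b, b \in B -> rval b = 0 \/ b \in G
    & forall y, y \in spairs G -> supp (appL G (reduce G y)) = [::]].
Proof.
move=> vB X; rewrite /generators; set G0 := [seq f <- B | _].
suff: [/\ all validl (completion G0), forall g, g \in completion G0 -> supp g != [::],
      forall g, g \in completion G0 -> incSpan X (rval g)
    & forall b, b \in B -> rval b = 0 \/ b \in completion G0].
  by move=> [h1 h2 h3 h4]; split=> //; apply: completion_complete.
apply: (completion_ind (P := fun G => [/\ all validl G, forall g, g \in G -> supp g != [::],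
  forall g, g \in G -> incSpan X (rval g) & forall b, b \in B -> rval b = 0 \/ b \in G])).
  split.
  - by apply/allP => g; rewrite mem_filter => /andP[_ /(allP vB)].
  - by move=> g; rewrite mem_filter => /andP[/nilP/eqP].
  - by move=> g; rewrite mem_filter => /andP[_ gB]; apply: incSpan_gen; exists g.
  - move=> b bB; case: (boolP (nilp (supp b))) => [/nilP z|nz].
      by left; apply: (rval_eq0 rank_inj) => //; apply: (allP vB).
    by right; rewrite mem_filter nz.
move=> G [vG nzG XG BG] inc.
have [rnz [y ys rE]] := mem_remainders inc; rewrite /add_remainder.
set r := head _ _ in rnz rE *; have gy := reduce_gterm (spair_gterm ys).
split.
- by rewrite all_rcons vG andbT rE; apply: validl_appL.
- by move=> g; rewrite mem_rcons inE => /orP[/eqP->|/nzG].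
- move=> g; rewrite mem_rcons inE => /orP[/eqP->|/XG//].
  by rewrite rE; apply: rval_appL_span.
- by move=> b /BG[|bG]; [left|right; rewrite mem_rcons inE bG orbT].
Qed.

End Generators.

Section Morphisms.
Context (K : fieldType) (c : nat) (M N : incModule K c) (phi : incHom M N).

Lemma incHom0 : phi 0 = 0.
Proof. exact: linear0. Qed.

Lemma incHomD x y : phi (x + y) = phi x + phi y.
Proof. exact: linearD. Qed.

Lemma incHomZ a x : phi (a *: x) = a *: phi x.
Proof. exact: linearZ. Qed.

Lemma kernel_submodule : incSubmodule (fun x => phi x = 0).
Proof.
split=> [|x y ex ey|a x ex|t x ex]; first exact: incHom0.
- by rewrite incHomD ex ey addr0.
- by rewrite incHomZ ex scaler0.
- by rewrite inc_homE ex inc_act0.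
Qed.

Lemma image_submodule : incSubmodule (fun y => exists x, phi x = y).
Proof.
split=> [|_ _ [x <-] [y <-]|a _ [x <-]|t _ [x <-]].
- by exists 0; apply: incHom0.
- by exists (x + y); apply: incHomD.
- by exists (a *: x); apply: incHomZ.
- by exists (inc_act t x); apply: inc_homE.
Qed.

End Morphisms.

Lemma perm_cons2_cat (T : eqType) (x y : T) s : perm_eq [:: x, y & s] (s ++ [:: x; y]).
Proof. by rewrite -[[:: x, y & s]]/([:: x; y] ++ s) perm_catC. Qed.

Lemma perm_cons_cons_cat (T : eqType) (x y z : T) s t :
  perm_eq (z :: (x :: s) ++ y :: t) [:: x, y, z & s ++ t].
Proof. by apply/permP => p; rewrite /= !count_cat /=; lia. Qed.

Lemma perm_cat_cons_cat (T : eqType) (x y z : T) r s t :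
  perm_eq ([:: x, y & r] ++ z :: s ++ t) [:: y, z & (x :: s) ++ r ++ t].
Proof. by apply/permP => p; rewrite /= !count_cat /= !count_cat; lia. Qed.

Section Merge.
Context (K : fieldType) (c : nat) (L : choiceType) (d : L -> nat) (rank : L -> nat).
Local Notation termval := (@termval K c L d rank).
Local Notation rval := (@rval K c L d rank).

Lemma rval_perm f g : perm_eq f g -> rval f = rval g.
Proof. by move=> e; rewrite /rval; apply: perm_big. Qed.

Lemma termvalD k l m : termval (k + l, m) = termval (k, m) + termval (l, m).
Proof.
rewrite /termval /= pmonoD; case: (unbasis _ _ _) => [b|]; first exact: scalerDl.
exact: esym (addr0 _).
Qed.

Lemma rval_merge k l m f : rval [:: (k, m), (l, m) & f] = rval ((k + l, m) :: f).
Proof. by rewrite !rval_cons termvalD; apply: addrA. Qed.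

Lemma rval_cons0 m f : rval ((0, m) :: f) = rval f.
Proof. by rewrite rval_cons termval0; apply: add0r. Qed.

End Merge.

(** * Syzygies *)

Section Schreyer.
Context (K : fieldType) (c : nat) (L L1 : choiceType) (d : L -> nat) (d1 : L1 -> nat).
Context (rank : L -> nat) (rank_inj : injective rank).
Context (rank1 : L1 -> nat) (rank1_inj : injective rank1).
Local Notation term := (term K c).
Local Notation mono := (mono c).
Local Notation termval1 := (@termval K c L1 d1 rank1).
Local Notation rval1 := (@rval K c L1 d1 rank1).
Local Notation rval := (@rval K c L d rank).
Context (G : seq (seq term)).
Hypothesis rank1_lt : forall l, (rank1 l < size G)%N.
Hypothesis rank1_surj : forall i, (i < size G)%N -> exists l, rank1 l = i.
Hypothesis d1E : forall l, d1 l = width (nth [::] G (rank1 l)).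
Hypothesis vG : all (@validl K c L d rank) G.
Hypothesis nzG : forall g, g \in G -> supp g != [::].
Hypothesis GP : forall y, y \in spairs G -> supp (appL G (reduce G y)) = [::].
Context (phi : incHom (freeInc K c d1) (freeInc K c d)).
Hypothesis phi_gen : forall l, phi (fgen K c d1 l) = rval (nth [::] G (rank1 l)).

Local Notation gterms y := (all (fun n : term => gterm G n.2) y).
Let syz (x : freeInc K c d1) := exists2 y, y \in [seq reduce G z | z <- spairs G] & x = rval1 y.
Local Notation S := (incSpan syz).

(** Identifies the syntactic condition on (i, p) with being a label of the free module on [G], so
    that records of reductions denote elements of it. *)
Lemma gterm_valid m : gterm G m = valid d1 rank1 m.2.
Proof.
case: m => vs q /=; apply/idP/idP.
  case: q => i p /and3P[/= iG sp /eqP szp]; have [l le] := rank1_surj iG; subst i.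
  by apply: valid_build; rewrite // d1E.
case/rawb_surj => b <-; apply/and3P; split; first exact: rank1_lt.
  exact: sorted_rawb.
by rewrite /= size_codom card_ord d1E.
Qed.

Lemma gterms_valid y : gterms y = validl d1 rank1 y.
Proof. by apply: eq_all => n; rewrite gterm_valid. Qed.

Lemma phi_termval n : gterm G n.2 -> phi (termval1 n) = rval (app G n).
Proof.
case: n => k [vs [i p]] gn; have [t [pE ->]] := rval_app rank_inj vG gn.
have /and3P[/= iG _ _] := gn; have [l le] := rank1_surj iG; subst i.
have {}pE : p = [seq t j | j <- iota 0 (d1 l)] by rewrite d1E; exact: pE.
rewrite pE (termval_fgen_act d1 rank1_inj k vs l t).
apply: etrans (incHomZ phi _ _) _.
by rewrite (inc_homE phi t) phi_gen.
Qed.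

Lemma phi_rval y : gterms y -> phi (rval1 y) = rval (appL G y).
Proof.
elim: y => [_|n y IH /andP[gn gy]]; first by rewrite !rval_nil; apply: incHom0.
rewrite rval_cons rval_appL_cons -(phi_termval gn) -(IH gy); exact: incHomD.
Qed.

Lemma syz_span_kernel x : S x -> phi x = 0.
Proof.
move=> /(_ (fun z => phi z = 0)); apply; first exact: kernel_submodule.
move=> _ [y /mapP[z zs ->] ->]; have gy := reduce_gterm (spair_gterm zs).
by rewrite phi_rval // (rval_eq0 rank_inj) ?GP //; apply: (validl_appL rank_inj).
Qed.

(** By [lift_spair] the pair is a multiple of a translate of a listed S-pair. The recorded
    reduction, moved in the same way, adds only terms with smaller leading monomials. *)
Lemma pair_syzygy m m' : gterm G m -> gterm G m' -> eqm (lam G m) (lam G m') ->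
  exists C u, [/\ gterms u, all (fun n => ltm (lam G n.2) (lam G m)) u
    & S (rval1 [:: (1, m), (C, m') & u])].
Proof.
move=> gm gm' e; have [t [b [m0 [m0' [ys [i0 i0'] [g0 g0'] e0 e0']]]]] := lift_spair nzG gm gm' e.
have [z [z' [[_ ez _ ez'] _ _ el]]] := spairsP ys; rewrite -{}ez -{}ez' in el => {z z'}.
have nzm0 : supp (nth [::] G m0.2.1) != [::] by case/and3P: g0 => iG _ _; apply: supp_nth.
have [y [yE gy lty]] := reduce_spair nzG g0 g0' el.
set a := lc (nth [::] G m0.2.1); have a0 : a != 0 by apply: lc_neq0.
(* The factor [a] undoes the inverse leading coefficient in the S-pair, so that [m] gets coefficient
   1. *)
pose lft (n : term) : term := (a * n.1, mulm b (act t n.2)).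
have vm : valid d1 rank1 m.2 by rewrite -gterm_valid.
have vm' : valid d1 rank1 m'.2 by rewrite -gterm_valid.
have g1 : gterm G (mulm b (act t m0)) by rewrite gterm_act.
have g1' : gterm G (mulm b (act t m0')) by rewrite gterm_act.
have [_ _ SZ SA] := incSpan_submodule syz.
have Sy : S (rval1 (map lft (reduce G (spair_of G m0 m0')))).
  have -> : rval1 (map lft (reduce G (spair_of G m0 m0'))) =
      pmono a b *: inc_act t (rval1 (reduce G (spair_of G m0 m0'))).
    rewrite (rval_act rank1_inj) ?rval_mulm -?map_comp // -gterms_valid.
    by apply: reduce_gterm; apply: spair_gterm.
  apply: (SZ _ _); apply: (SA t); apply: incSpan_gen.
  by exists (reduce G (spair_of G m0 m0')) => //; apply: map_f.
exists (a * - (lc (nth [::] G m0'.2.1))^-1), (map lft y); split.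
- by apply/allP => _ /mapP[n /(allP gy) gn ->]; rewrite /= gterm_act.
- apply/allP => _ /mapP[n ny ->] /=; have gn := allP gy n ny.
  have nzn : supp (nth [::] G n.2.2.1) != [::] by case/and3P: gn => iG _ _; apply: supp_nth.
  rewrite lam_act //; have := ltm_mulm b (ltm_act t (allP lty n ny)).
  rewrite -(lam_act t b g0 nzm0).
  have em : eqm (lam G m) (lam G (mulm b (act t m0))).
    by apply: lam_eqm.
  by rewrite (eqm_ltmr _ em).
rewrite yE map_cat in Sy.
rewrite (@rval_perm _ _ _ _ _ _ (map lft y ++ [:: (1, m); (a * - (lc (nth [::] G m0'.2.1))^-1, m')])); last first.
  exact: perm_cons2_cat.
rewrite rval_cat !rval_cons in Sy; rewrite rval_cat !rval_cons.
have v0 : valid d1 rank1 (mulm b (act t m0)).2 by rewrite -gterm_valid.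
have v0' : valid d1 rank1 (mulm b (act t m0')).2 by rewrite -gterm_valid.
have l1 : lft ((lc (nth [::] G m0.2.1))^-1, m0) = (1, mulm b (act t m0)).
  by rewrite /lft /= mulfV.
rewrite (termval_perm 1 e0 vm v0) -l1.
rewrite (termval_perm _ e0' vm' v0').
exact: Sy.
Qed.

(** Modulo syzygies and smaller terms, [pair_syzygy] makes all terms with the leading monomial of
    [m0] multiples of [m0]; they collapse into one. *)
Lemma span_reduce m0 y : gterm G m0 -> gterms y ->
  all (fun n => eqm (lam G n.2) (lam G m0) || ltm (lam G n.2) (lam G m0)) y ->
  exists C u, [/\ gterms u, all (fun n => ltm (lam G n.2) (lam G m0)) u
    & S (rval1 ((C, m0) :: y ++ u))].
Proof.
move=> g0; have [S0 SD SZ _] := incSpan_submodule syz.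
elim: y => [|n y IH] /=; first by exists 0, [::]; rewrite rval_cons0 rval_nil.
case/andP => gn gy /andP[en ey]; have [C [u [gu ltu Su]]] := IH gy ey.
have [e|ne] := boolP (eqm (lam G n.2) (lam G m0)); last first.
  (* A term that is already smaller is cancelled by its negative in [u]. *)
  exists C, ((- n.1, n.2) :: u); split; rewrite /= ?gn ?gu //.
    by move: en; rewrite (negbTE ne) => /= ->.
  rewrite (@rval_perm _ _ _ _ _ _ [:: (n.1, n.2), (- n.1, n.2), (C, m0) & y ++ u]).
    by rewrite rval_merge addrN rval_cons0.
  rewrite -surjective_pairing; exact: perm_cons_cons_cat.
have [C1 [u1 [gu1 ltu1 Su1]]] := pair_syzygy gn g0 e.
exists (n.1 * C1 + C), ([seq (n.1 * v.1, v.2) | v <- u1] ++ u); split.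
- by rewrite all_cat gu andbT all_map.
- rewrite all_cat ltu andbT all_map; apply: sub_all ltu1 => v /=.
  by rewrite (eqm_ltmr _ e).
rewrite -rval_merge.
have := SD _ _ (SZ (pmono n.1 [::]) _ Su1) Su; rewrite scale_rval -rval_cat.
rewrite !map_cons (rval_perm _ _ (perm_cat_cons_cat _ _ _ _ _ _)).
by rewrite [(n.1 * 1)]mulr1 -surjective_pairing.
Qed.

Lemma rcoef_appL_lt u M : gterms u -> all (fun n => ltm (lam G n.2) M) u ->
  rcoef (appL G u) M = 0.
Proof.
elim: u => //= n u IH /andP[gn gu] /andP[ln lu]; rewrite rcoef_appL_cons IH // addr0.
apply/eqP; apply: contraT; rewrite [n]surjective_pairing => nz.
by have := app_lt nzG gn ln nz; rewrite ltm_irr.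
Qed.

Lemma lam_maximal u : u != [::] -> gterms u -> exists2 n, n \in u &
  all (fun n' => eqm (lam G n'.2) (lam G n.2) || ltm (lam G n'.2) (lam G n.2)) u.
Proof.
case: u => // n0 u0 _ _; set u := _ :: _.
have [|m /mapP[n nu ->] /allP mx] := @ltm_maximal c [seq lam G n.2 | n <- u] (lam G n0.2).
  exact: mem_head.
exists n => //; apply/allP => n' nu'; have := mx _ (map_f _ nu').
by have := ltm_total (lam G n'.2) (lam G n.2); case: ltm; case: eqm => //= ->.
Qed.

(* Schreyer: a relation with leading monomials bounded by M reduces to a
   multiple of one generator of that leading monomial, which must vanish, plus
   a relation with smaller leading monomials. *)
Lemma kernel_sub_span_bounded M m0 y : lam G m0 = M -> gterm G m0 -> gterms y ->
  all (fun n => eqm (lam G n.2) (lam G m0) || ltm (lam G n.2) (lam G m0)) y ->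
  phi (rval1 y) = 0 -> S (rval1 y).
Proof.
elim: (ltm_wf M) m0 y => {}M _ IH m0 y e0 g0 gy ley y0.
have [C [u [gu ltu Su]]] := span_reduce g0 gy ley.
have catE : rval1 ((C, m0) :: y ++ u) = rval1 y + rval1 ((C, m0) :: u).
  by rewrite -rval_cat; apply: rval_perm; apply: (permEl (perm_catCA [:: _] _ _)).
have z : phi (rval1 ((C, m0) :: u)) = 0.
  have := syz_span_kernel Su; rewrite catE => h; rewrite -{}h.
  by apply: esym; apply: etrans (incHomD phi _ _) _; rewrite y0; apply: add0r.
have nz0 : supp (nth [::] G m0.2.1) != [::] by case/and3P: (g0) => iG _ _; apply: supp_nth.
(* The other terms have smaller leading monomials, so the image has coefficient C times a nonzero
   leading coefficient at [lam G m0]. *)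
have C0 : C = 0.
  have zr : kcoef rank (lam G m0) (rval (appL G ((C, m0) :: u))) = 0.
    by rewrite -(phi_rval (y := (C, m0) :: u)) ?z /= ?g0 //; apply: kcoef0.
  move: zr; rewrite (kcoef_rval rank_inj); last first.
    by apply: (validl_appL rank_inj); rewrite //= g0.
  have [al _] := app_lam C g0 nz0.
  rewrite rcoef_appL_cons al (rcoef_appL_lt gu ltu) addr0 => /eqP.
  by rewrite mulf_eq0 (negbTE (lc_neq0 nz0)) orbF => /eqP.
rewrite C0 rval_cons0 in z catE.
have SU : S (rval1 u).
  have [->|ne] := eqVneq u [::]; first by rewrite rval_nil; case: (incSpan_submodule syz).
  have [n nu mx] := lam_maximal ne gu.
  apply: (IH (lam G n.2)) mx z => //; last exact: (allP gu).
  by rewrite -e0; apply: (allP ltu).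
have -> : rval1 y = rval1 ((C, m0) :: y ++ u) - rval1 u.
  by rewrite C0 catE; apply: esym; apply: addrK.
exact: incSpanB.
Qed.

Theorem kernel_syz x : phi x = 0 <-> S x.
Proof.
split=> [|/syz_span_kernel //]; have [y vy <-] := rval_surj rank1_inj x => y0.
have gy : gterms y by rewrite gterms_valid.
have [->|ne] := eqVneq y [::]; first by rewrite rval_nil; case: (incSpan_submodule syz).
have [n ny mx] := lam_maximal ne gy.
by apply: (kernel_sub_span_bounded (erefl _) _ gy mx y0); apply: (allP gy).
Qed.

End Schreyer.

(** * Expressions and lists of terms *)

Section Expressions.
Context (K : fieldType) (c : nat) (L : choiceType) (d : L -> nat).
Context (rank : L -> nat) (rank_inj : injective rank).
Local Notation F := (freeInc K c d).
Local Notation rval := (@rval K c L d rank).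

Definition decode (f : seq (term K c)) : seq (pexpr K c * fbasis d) :=
  pmap (fun t => omap (fun b => ([:: (t.1, t.2.1)], b)) (unbasis d rank t.2.2)) f.

Definition erase (e : seq (pexpr K c * fbasis d)) :=
  [seq (u.1, rawb rank u.2) | u <- e].

Lemma sum_decode f :
  \sum_(u <- decode f) pval u.1 *: (<< 1 *g u.2 >> : free_car K c d) = rval f :> F.
Proof.
elim: f => [|t f IH]; first by rewrite rval_nil big_nil.
rewrite rval_cons -IH /termval /decode /=; case: (unbasis _ _ _) => [b|] /=; last first.
  by apply: esym; apply: add0r.
have e : pval [:: (t.1, t.2.1)] = pmono t.1 t.2.1 by rewrite pmonoE /pval big_seq1.
rewrite big_cons -e; reflexivity.
Qed.

Lemma rval_terms_of_input e : rval (terms_of_input (erase e)) =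
  \sum_(u <- e) pval u.1 *: (<< 1 *g u.2 >> : free_car K c d) :> F.
Proof.
rewrite /terms_of_input; elim: e => [|[p b] e IH]; first by rewrite rval_nil big_nil.
rewrite big_cons -IH /= rval_cat; congr (_ + _).
elim: p => [|w p IHp] /=.
  by rewrite rval_nil /pval big_nil; apply: esym; apply: scale0r.
rewrite rval_cons IHp /pval big_cons /termval /= (rawbK rank_inj) pmonoE.
by apply: esym; apply: scalerDl.
Qed.

Lemma validl_terms_of_input e : validl d rank (terms_of_input (erase e)).
Proof.
apply/allP => t /flatten_mapP[_ /mapP[u _ ->] /mapP[w _ ->]] /=.
exact: valid_rawb.
Qed.

(** [decode] would drop invalid terms; on valid lists nothing is lost, so the computed code is that
    of the expressions claimed as output. *)
Lemma erase_decode f : validl d rank f -> erase (decode f) = output_of_terms f.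
Proof.
rewrite /erase /decode /output_of_terms; elim: f => //= t f IH /andP[vt vf].
case E : (unbasis _ _ _) vt => [b|]; rewrite /valid ?E //= => _.
by rewrite (unbasisP E) IH.
Qed.

End Expressions.

Lemma incSpan_ext (K : fieldType) (c : nat) (M : incModule K c) (X Y : M -> Prop) :
  (forall x, X x <-> Y x) -> forall x, incSpan X x <-> incSpan Y x.
Proof.
by move=> e x; split=> h S sS XS; apply: h => // y /e /XS.
Qed.

(** * One step of the resolution *)

Section Step.
Context (K : fieldType) (c : nat) (ds ds1 : seq nat) (B : seq (seq (term K c))).
Local Notation rval ds := (@rval K c _ (@Defs.fdeg ds) (@nat_of_ord (size ds))).
Local Notation validl ds := (@validl K c _ (@Defs.fdeg ds) (@nat_of_ord (size ds))).
Local Notation G := (generators B).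
Hypothesis vB : all (validl ds) B.
(** An equation rather than a definition of [ds1]: in the final chain the degrees are entries of a
    list, equal to these only by a proof. *)
Hypothesis ds1E : ds1 = [seq width g | g <- G].

Let size_ds1 : size ds1 = size G. Proof. by rewrite ds1E size_map. Qed.

Let ds1_lt (l : 'I_(size ds1)) : (l < size G)%N.
Proof. by rewrite -size_ds1. Qed.

Let ds1_surj i : (i < size G)%N -> exists l : 'I_(size ds1), nat_of_ord l = i.
Proof. by rewrite -size_ds1 => iG; exists (Ordinal iG). Qed.

Let ds1_width (l : 'I_(size ds1)) : Defs.fdeg l = width (nth [::] G l).
Proof.
have nthE k : (k < size G)%N -> nth 0%N ds1 k = width (nth [::] G k).
  by move=> kG; rewrite ds1E (nth_map [::]).
by apply: nthE; rewrite -size_ds1.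
Qed.

(** [free_hom_exists] applies because the columns of each generator lie below its width, the degree
    assigned to it. *)
Lemma step_hom : exists phi : incHom (freeSeq K c ds1) (freeSeq K c ds),
  forall i, phi (fseq_gen K c i) = rval ds (nth [::] G i).
Proof.
have [vG _ _ _ _] := generatorsP (@ord_inj (size ds)) vB.
apply: free_hom_exists => l t t' e; rewrite !(rval_act (@ord_inj (size ds))) ?validl_nth //.
congr (rval ds _); apply/eq_in_map => u uG; congr (_, _); apply: act_eq_in => j ju.
by apply: e; rewrite ds1_width; apply: cols_width ju.
Qed.

Context (phi : incHom (freeSeq K c ds1) (freeSeq K c ds)).
Hypothesis phi_gen : forall i, phi (fseq_gen K c i) = rval ds (nth [::] G i).

(** Completion adds only elements of the span and drops only zeros, so the image is generated by [B]
    itself. *)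
Lemma step_image x : (exists y, phi y = x) <->
  incSpan (fun z => exists2 b, b \in B & z = rval ds b) x.
Proof.
have [vG nzG XG BG _] := generatorsP (@ord_inj (size ds)) vB; split.
  move=> [y <-]; have [f vf <-] := rval_surj (@ord_inj (size ds1)) y.
  have gf : all (fun n => gterm G n.2) f.
    apply: sub_all vf => n.
    by rewrite (gterm_valid (@ord_inj (size ds1)) ds1_lt ds1_surj ds1_width).
  rewrite (phi_rval (@ord_inj _) (@ord_inj _) ds1_surj ds1_width vG phi_gen) //.
  exact: (rval_appL_span (@ord_inj _) vG XG gf).
move=> /(_ (fun x => exists y, phi y = x)); apply; first exact: image_submodule.
move=> _ [b bB ->]; have [->|bG] := BG b bB; first by exists 0; apply: incHom0.
have [|l le] := @ds1_surj (index b G); first by rewrite index_mem.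
by exists (fseq_gen K c l); rewrite phi_gen le nth_index.
Qed.

Lemma step_kernel x : phi x = 0 <->
  incSpan (fun z => exists2 b, b \in syzygies B & z = rval ds1 b) x.
Proof.
have [vG nzG _ _ GP] := generatorsP (@ord_inj (size ds)) vB.
apply: (kernel_syz (@ord_inj _) (@ord_inj _) ds1_lt ds1_surj ds1_width vG nzG GP phi_gen).
Qed.

Lemma step_valid : all (validl ds1) (syzygies B).
Proof.
apply/allP => _ /mapP[y ys ->]; have := reduce_gterm (spair_gterm ys).
by apply: sub_all => n; rewrite (gterm_valid (@ord_inj (size ds1)) ds1_lt ds1_surj ds1_width).
Qed.

End Step.

Section Codes.
Context (K : fieldType) (c : nat).

Lemma enc_seq_map (S T : Type) (e : T -> data K) (f : S -> T) (s : seq S) :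
  enc_seq e (map f s) = enc_seq (e \o f) s.
Proof. by rewrite /enc_seq foldr_map. Qed.

Lemma eq_in_enc_seq (T : eqType) (e e' : T -> data K) (s : seq T) :
  {in s, e =1 e'} -> enc_seq e s = enc_seq e' s.
Proof.
elim: s => //= x s IH e_e'; rewrite e_e' ?mem_head // IH // => y ys.
by apply: e_e'; rewrite inE ys orbT.
Qed.

Lemma enc_fexpr_erase ds (e : fexpr K c ds) :
  enc_fexpr e = encode (erase (@nat_of_ord (size ds)) e).
Proof. by rewrite /encode /code_seq /erase enc_seq_map. Qed.

Lemma enc_input_erase s ds (B : seq (fexpr K c ds)) :
  enc_input s B = encode (s, (ds, map (erase (@nat_of_ord (size ds))) B)).
Proof.
rewrite /enc_input /encode /code_prod /enc_pair /=; congr (Defs.Cons _ (Defs.Cons _ _)).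
rewrite /code_seq enc_seq_map; elim: B => //= e B ->; by rewrite enc_fexpr_erase.
Qed.

End Codes.

Lemma codom_nth (T : Type) (n : nat) (s : seq T) (S : Type) (f : T -> S) (x : T) :
  n = size s -> codom (fun i : 'I_n => f (nth x s i)) = map f s.
Proof.
move=> ->; rewrite codomE -[in RHS](mkseq_nth x s) /mkseq -val_enum_ord -!map_comp.
exact: eq_map.
Qed.

Theorem mainTheorem4 (K : fieldType) (c : nat) (c_ge1 : (1 <= c)%N) :
  exists A : prog,
  forall (s : nat) (ds : seq nat) (B : seq (fexpr K c ds)), (1 <= s)%N ->
  exists (es : seq (seq nat))
    (im : chain_images K c (ds :: es))
    (phi : forall j, incHom (freeSeq K c (rank_at (ds :: es) j.+1))
                            (freeSeq K c (rank_at (ds :: es) j))),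
  [/\ size es = s,
      run A (enc_input s B) (enc_output im),
      forall j (i : 'I_(size (rank_at (ds :: es) j.+1))),
        phi j (fseq_gen K c i) = fval (im j i),
      forall x : freeSeq K c ds,
        (exists y, phi 0%N y = x) <->
        incSpan (fun b => b \in [seq fval e | e <- B]) x
    & forall j, (j.+1 < s)%N -> exact_at (phi j.+1) (phi j)].
Proof.
have [A runA] := @c_resolution K c; exists A => s ds B s_gt0.
(* Level k resolves the submodule generated by [Bk k]: the input for k = 0, and the kernel of the
   preceding map afterwards. *)
pose Bk k := iter k (@syzygies K c)
  [seq terms_of_input e | e <- map (erase (@nat_of_ord (size ds))) B].
pose R j := if j is k.+1 then [seq width g | g <- generators (Bk k)] else ds.
pose es := [seq R k.+1 | k <- iota 0 s].
have RE j : (j <= s)%N -> rank_at (ds :: es) j = R j.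
  by case: j => // j js; rewrite /rank_at /= (nth_map 0%N) ?size_iota // nth_iota.
pose im : chain_images K c (ds :: es) :=
  fun j i => decode (@Defs.fdeg (rank_at (ds :: es) j)) (@nat_of_ord (size (rank_at (ds :: es) j))) (nth [::] (generators (Bk j)) i).
have fim j i : fval (im j i) =
    @rval K c _ (@Defs.fdeg (rank_at (ds :: es) j)) (@nat_of_ord _) (nth [::] (generators (Bk j)) i).
  exact: sum_decode.
have vB j : all (@validl K c _ (@Defs.fdeg (R j)) (@nat_of_ord (size (R j)))) (Bk j).
  elim: j => [|j IH]; last exact: (step_valid (ds1 := R j.+1) (erefl _)).
  apply/allP => _ /mapP[_ /mapP[e _ ->] ->]; exact: (validl_terms_of_input (@ord_inj (size ds)) e).
have vB' j : (j <= s)%N -> all (@validl K c _ (@Defs.fdeg (rank_at (ds :: es) j))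
    (@nat_of_ord (size (rank_at (ds :: es) j)))) (Bk j).
  by move=> /RE ->.
have RE' j : (j < s)%N -> rank_at (ds :: es) j.+1 = [seq width g | g <- generators (Bk j)].
  exact: RE.
have ex_phi j : exists phi : incHom (freeSeq K c (rank_at (ds :: es) j.+1))
                                    (freeSeq K c (rank_at (ds :: es) j)),
    forall i, phi (fseq_gen K c i) = fval (im j i).
  have [js|js] := ltnP j s.
    have [phi phiE] := step_hom (vB' j (ltnW js)) (RE' j js).
    by exists phi => i; rewrite phiE fim.
  (* A map is required for every j; past position s [rank_at] returns the empty list, so the source
     has no generators. *)
  have no (l : 'I_(size (rank_at (ds :: es) j.+1))) : False.
    by have := ltn_ord l; rewrite {2}/rank_at /= nth_default ?size_map ?size_iota.
  by apply: free_hom_exists => l; case: (no l).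
pose phi j := proj1_sig (constructive_indefinite_description _ (ex_phi j)).
have phiE j i : phi j (fseq_gen K c i) = fval (im j i).
  exact: (proj2_sig (constructive_indefinite_description _ (ex_phi j))).
have phiE' j i : phi j (fseq_gen K c i) =
    @rval K c _ (@Defs.fdeg (rank_at (ds :: es) j)) (@nat_of_ord _) (nth [::] (generators (Bk j)) i).
  by rewrite phiE fim.
exists es, im, phi; split.
- by rewrite size_map size_iota.
- rewrite enc_input_erase.
  apply: (eq_ind _ (run A _) (runA (s, (ds, map (erase (@nat_of_ord (size ds))) B)))).
  apply: esym; rewrite /enc_output -[(size (ds :: es)).-1]/(size es) size_map size_iota.
  rewrite /resolution /code_seq enc_seq_map.
  apply: eq_in_enc_seq => j; rewrite mem_iota add0n => /andP[_ js].
  rewrite [RHS]/= /code_prod /enc_pair [RHS]/=; congr (Defs.Cons _ _); first by rewrite RE'.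
  have -> : codom (im j) = map (decode (@Defs.fdeg (rank_at (ds :: es) j)) (@nat_of_ord _))
      (generators (Bk j)) by apply: codom_nth; rewrite RE' // size_map.
  rewrite !enc_seq_map.
  have [vG _ _ _ _] := generatorsP (@ord_inj _) (vB' j (ltnW js)).
  apply: eq_in_enc_seq => g gG /=; rewrite enc_fexpr_erase erase_decode //.
  exact: (allP vG).
- exact: phiE.
- move=> x; apply: iff_trans (step_image (vB' 0%N (leq0n s)) (RE' 0%N s_gt0) (phiE' 0%N) x) _.
  apply: incSpan_ext => z; split.
    case=> _ /mapP[_ /mapP[e eB ->] ->] ->; apply/mapP; exists e => //.
    exact: (rval_terms_of_input (@ord_inj (size ds))).
  case/mapP => e eB ->.
  exists (terms_of_input (erase (@nat_of_ord (size ds)) e)); first by do 2!apply: map_f.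
  apply: esym; exact: (rval_terms_of_input (@ord_inj (size ds))).
- move=> j js x.
  (* [Bk j.+1] is [syzygies (Bk j)], so the kernel of one map and the image of the next are the span
     of the same elements. *)
  apply: iff_trans (step_kernel (vB' j (ltnW (ltnW js))) (RE' j (ltnW js)) (phiE' j) x) _.
  apply: iff_sym; exact: (step_image (vB' j.+1 (ltnW js)) (RE' j.+1 js) (phiE' j.+1) x).
Qed.
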